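(* If $X$ and $Y$ are nowhere locally compact, completely metrizable spaces with the same cellular type, then there are an open dense subspace of $\varrho(X)$ and an open dense subspace of $\varrho(Y)$ that are homeomorphic to each other.
   Context: For a Tychonoff space $X$, $\beta X$ is its Čech–Stone compactification and $X^\ast=\beta X\setminus X$. A point $p\in X^\ast$ is a remote point of $X$ if $p\notin \mathrm{cl}_{\beta X}(A)$ for every nowhere dense subset $A$ of $X$. $\varrho(X)$ denotes the set of remote points of $X$, with the subspace topology from $\beta X$. A space is nowhere locally compact if none of its points has a compact neighborhood. The cellularity $c(X)$ is the supremum of the cardinalities of pairwise disjoint families of non-empty open subsets of $X$. $X$ is of uniform cellularity $\kappa$ if $c(X)=\kappa$ and $c(U)=\kappa$ for every non-empty open $U\subset X$. Cellular type: let $\mathcal{S}$ be a set of infinite cardinals and $\phi$ a function with domain $\mathcal{S}$ such that for each $\kappa\in\mathcal{S}$, $\phi(\kappa)$ is a cardinal $\geq\kappa$. A space $X$ has cellular type $(\mathcal{S},\phi)$ if there is a pairwise disjoint family $\mathcal{B}=\{V(\kappa,\alpha):\kappa\in\mathcal{S},\alpha<\phi(\kappa)\}$ of open subsets of $X$ (indexed so that sets with different indices are disjoint) whose union is dense in $X$ and such that each $V(\kappa,\alpha)$ is of uniform cellularity $\kappa$. ''The same cellular type'' means that for some pair $(\mathcal{S},\phi)$ both spaces have cellular type $(\mathcal{S},\phi)$. *)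

(* Defs.v *)
From HB Require Import structures.
From mathcomp Require Import all_boot all_order all_algebra.
From mathcomp Require Import all_classical all_reals all_analysis.
Import Order.TTheory GRing.Theory Num.Theory.
Import numFieldNormedType.Exports.

Set Implicit Arguments.
Unset Strict Implicit.
Unset Printing Implicit Defensive.

Local Open Scope classical_set_scope.
Local Open Scope card_scope.
Local Open Scope ring_scope.

Definition homeomorphic (S T : topologicalType) : Prop :=
  exists (f : S -> T) (g : T -> S),
    [/\ cancel f g, cancel g f, continuous f & continuous g].

Definition nowhere_dense (T : topologicalType) (A : set T) : Prop :=
  interior (closure A) = set0.

Definition nowhere_locally_compact (T : topologicalType) : Prop :=
  forall (x : T) (K : set T), compact K -> ~ nbhs x K.

(* [metricType] does not require a base point, unlike [completeType], so the
   empty space is covered. *)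
Definition completely_metrizable (R : realType) (T : topologicalType) : Prop :=
  exists M : metricType R,
    homeomorphic T M /\
    forall u : nat -> M, cauchy (u @ \oo) -> exists l : M, u @ \oo --> l.

Section StoneCech.
Variables (R : realType) (X : topologicalType).

Definition unit_functions : set (X -> R) :=
  [set f : X -> R | continuous f /\ range f `<=` `[0, 1]].

Definition evaluation (x : X) : {ptws unit_functions -> R} :=
  fun f => val f x.

(* Tychonoff's construction: the closure of the image of X in the cube
   [0, 1]^C(X, [0, 1]); the lemmas below show that this is the Cech-Stone
   compactification when X is completely regular and Hausdorff. *)
Definition stone_cech : topologicalType :=
  set_type (closure (range evaluation)).

Lemma evaluation_closure (x : X) :
  evaluation x \in closure (range evaluation).
Proof. by rewrite inE; apply: subset_closure; exists x. Qed.

Definition to_stone_cech (x : X) : stone_cech :=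
  exist _ (evaluation x) (evaluation_closure x).

Definition remainder : set stone_cech := ~` range to_stone_cech.

Definition remote_points : set stone_cech :=
  [set p | remainder p /\
    forall A : set X, nowhere_dense A -> ~ closure (to_stone_cech @` A) p].

Lemma projection_continuous (f : unit_functions) :
  continuous (fun p : stone_cech => val p f).
Proof.
move=> p; apply: (@continuous_comp stone_cech {ptws unit_functions -> R} R
  (fun q => val q) (fun q => q f)).
  exact: (@initial_continuous _ _ set_val).
exact: (@proj_continuous _ (fun=> R)).
Qed.

Lemma evaluation_continuous : continuous evaluation.
Proof.
move=> x; apply/cvg_sup => f A [B [[C oC <-] Cx] CA].
have [cf _] : unit_functions (val f) by have := valP f; rewrite inE.
apply: (@filterS _ (nbhs x) _ (val f @^-1` C)).
  by move=> y Cy; exact: CA.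
exact/cf/open_nbhs_nbhs.
Qed.

Lemma to_stone_cech_continuous : continuous to_stone_cech.
Proof.
apply/continuousP => A [B oB <-].
by have /continuousP := evaluation_continuous; exact.
Qed.

Lemma stone_cech_compact : compact [set: stone_cech].
Proof.
pose cube := [set q : {ptws unit_functions -> R} |
  forall f, `[0, 1]%classic (q f)].
have co_cube : compact cube.
  apply: (@tychonoff unit_functions (fun=> R) (fun=> `[0, 1]%classic)) => f.
  exact: segment_compact.
have cl_cube : closed cube.
  apply: compact_closed co_cube; apply: (@hausdorff_product _ (fun=> R)) => f.
  exact: Rhausdorff.
have cC : compact (closure (range evaluation)).
  apply: (@subclosed_compact _ _ cube); first exact: closed_closure.
    exact: co_cube.
  have /closure_id -> := cl_cube; apply: closure_subset => _ [x _ <-] f.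
  have [_] : unit_functions (val f) by have := valP f; rewrite inE.
  by apply; exists x.
move=> F PF _.
have [|q [Cq Fq]] := cC ((fun p : stone_cech => val p) @ F) _.
  by apply: (@filterE _ F) => p /=; have := valP p; rewrite inE.
exists (exist _ q (mem_set Cq)); split => // A B FA [_ [[D oD <-] Dq] DB].
have [||_ [[p Ap <-] Dp]] := Fq (val @` A) D.
- by apply: (@filterS _ F _ A) FA => p Ap; exists p.
- exact: open_nbhs_nbhs.
by exists p; split => //; exact: DB.
Qed.

Lemma stone_cech_hausdorff : hausdorff_space stone_cech.
Proof.
move=> p q pq; apply: val_inj; apply: functional_extensionality_dep => f.
apply: (@norm_hausdorff R R^o) => A B pA qB.
have [||r [Ar Br]] := pq ((fun p => val p f) @^-1` A) ((fun p => val p f) @^-1` B).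
- exact: projection_continuous.
- exact: projection_continuous.
by exists (val r f).
Qed.

Lemma to_stone_cech_dense : dense (range to_stone_cech).
Proof.
move=> O [p Op] [B oB BO]; have Bp : B (val p) by move: Op; rewrite -BO.
have /= := valP p; rewrite inE => /(_ B (open_nbhs_nbhs (conj oB Bp))).
move=> [_ [[x _ <-] Bx]]; exists (to_stone_cech x); split; last by exists x.
by rewrite -BO.
Qed.

Lemma unit_function_extends (f : X -> R) :
  continuous f -> range f `<=` `[0, 1] ->
  exists2 g : stone_cech -> R, continuous g & g \o to_stone_cech = f.
Proof.
move=> cf f01.
have Hf : f \in unit_functions by rewrite inE.
by exists (fun p => val p (exist _ f Hf)); first exact: projection_continuous.
Qed.

Lemma to_stone_cech_nbhs : @completely_regular_space X ->
  forall x (A : set X), nbhs x A ->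
  exists2 B, nbhs (to_stone_cech x) B & to_stone_cech @^-1` B `<=` A.
Proof.
move=> crX x A; rewrite nbhsE => -[U [oU Ux] UA].
have /(@uniform_separatorP _ R)[f [cf f01 f0 f1]] :
  uniform_separator [set x] (~` U).
  by apply: crX; [exact: open_closedC|exact: (fun h => h Ux)].
have uf : f \in unit_functions by rewrite inE.
have fx : f x = 0 by apply: f0; exists x.
exists ((fun p : stone_cech => val p (exist _ f uf)) @^-1` [set y | y < 1]).
  apply: projection_continuous.
  suff : nbhs (f x) [set y | y < 1] by [].
  by rewrite fx; apply: open_nbhs_nbhs; split; [exact: open_lt|exact: ltr01].
move=> y /= fy; apply: UA; apply: contrapT => nUy.
have fy1 : f y = 1 by apply: f1; exists y.
by have : f y < 1 := fy; rewrite fy1 ltxx.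
Qed.

Lemma to_stone_cech_inj : @completely_regular_space X -> hausdorff_space X ->
  injective to_stone_cech.
Proof.
move=> crX hX x y xy; apply: hX => A B /(to_stone_cech_nbhs crX)[A' xA' AA'].
move=> /(to_stone_cech_nbhs crX)[B' yB' BB']; exists x; split.
  by apply: AA'; exact: nbhs_singleton xA'.
by apply: BB'; rewrite /preimage /= xy; exact: nbhs_singleton yB'.
Qed.

End StoneCech.
Arguments to_stone_cech R {X} x.
Arguments remainder R X : clear implicits.
Arguments remote_points R X : clear implicits.

(* Cardinals are represented by types, compared up to equipotence with the
   library relations [#<=] and [#=]. *)
Definition cardinal := Type.

Definition cellular_family (T : topologicalType) (F : set (set T)) : Prop :=
  (forall U, F U -> open U /\ U !=set0) /\ trivIset F id.

(* c(T) = K, that is, K is the least upper bound of the cardinalities of the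
   cellular families of T. *)
Definition cellularity_eq (T : topologicalType) (K : cardinal) : Prop :=
  (forall F : set (set T), cellular_family F -> F #<= [set: K]) /\
  forall L : cardinal,
    (forall F : set (set T), cellular_family F -> F #<= [set: L]) ->
    [set: K] #<= [set: L].

Definition uniform_cellularity (T : topologicalType) (K : cardinal) : Prop :=
  cellularity_eq T K /\
  forall U : set T, open U -> U !=set0 -> cellularity_eq U K.

(* A set S of infinite cardinals, given as a family of pairwise
   non-equipotent types, with a function phi such that kappa <= phi(kappa). *)
Record cellular_data := CellularData {
  cd_index : Type;
  cd_card : cd_index -> cardinal;
  cd_phi : cd_index -> cardinal;
  cd_card_inj : forall i j, [set: cd_card i] #= [set: cd_card j] -> i = j;
  cd_card_infinite : forall i, infinite_set [set: cd_card i];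
  cd_card_le_phi : forall i, [set: cd_card i] #<= [set: cd_phi i] }.

(* The indices alpha < phi(kappa) are the elements of the type [cd_phi]. *)
Definition has_cellular_type (T : topologicalType) (S : cellular_data) : Prop :=
  exists V : {i : cd_index S & cd_phi i} -> set T,
    [/\ forall s, open (V s),
        trivIset setT V,
        dense (\bigcup_s V s) &
        forall s, uniform_cellularity (V s) (cd_card (tag s))].

Definition same_cellular_type (X Y : topologicalType) : Prop :=
  exists S : cellular_data, has_cellular_type X S /\ has_cellular_type Y S.

(* Main.v *)
(* An open set [V] of uniform cellularity [K] in a complete, nowhere locally compact
   metric space carries a tree of open cells, indexed by finite sequences in [K]:
   the children of a cell are disjoint, locally finite, small and dense in it. Their
   existence follows as in Stone's paracompactness theorem, and nowhere local
   compactness makes the number of children exactly [K]. Sending a branch to the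
   point in the closures of its cells is a closed irreducible map from the Baire
   space [K^nat] onto the closure of [V].

   Such a map extends to the Cech-Stone compactifications, and this extension is a
   homeomorphism between the points avoiding all nowhere dense sets on both sides:
   closed irreducible maps preserve and reflect nowhere dense closed sets, and a
   remote point of [X] has only one preimage. So the remote points of [X] in the
   closure of [V] depend only on [K]. These pieces are open and pairwise disjoint,
   whence the homeomorphism; their union is dense because every cylinder of [K^nat]
   has remote points in its closure (van Douwen's linked families). *)

From HB Require Import structures.
Require Import Defs.
From mathcomp Require Import all_boot all_order all_algebra.
From mathcomp Require Import all_classical all_reals all_analysis.
From mathcomp Require Import lra.
From mathcomp Require wochoice.
Import Order.TTheory GRing.Theory Num.Theory.
Import numFieldNormedType.Exports.

Set Implicit Arguments.
Unset Strict Implicit.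
Unset Printing Implicit Defensive.

Local Open Scope classical_set_scope.
Local Open Scope card_scope.

(** * Extension to the Cech-Stone compactification *)

Lemma continuous_ptws (S T : topologicalType) (I : Type)
    (g : S -> {ptws I -> T}) :
  (forall i, continuous (fun x => g x i)) -> continuous g.
Proof.
move=> cg x; apply/cvg_sup => i A [B [[C oC <-] Cx] CA].
apply: (@filterS _ (nbhs x) _ ((fun x => g x i) @^-1` C)).
  by move=> y Cy; exact: CA.
exact/cg/open_nbhs_nbhs.
Qed.

Section StoneCechMap.
Variables (R : realType) (S T : topologicalType) (f : S -> T).
Hypothesis cf : continuous f.

Lemma unit_functions_comp (g : @unit_functions R T) :
  (val g \o f) \in @unit_functions R S.
Proof.
have [cg g01] : @unit_functions R T (val g) by have := valP g; rewrite inE.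
rewrite inE; split; first by move=> x; apply: continuous_comp; [exact: cf|exact: cg].
by move=> _ [x _ <-]; apply: g01; exists (f x).
Qed.

Definition unit_comp (g : @unit_functions R T) : @unit_functions R S :=
  exist _ (val g \o f) (unit_functions_comp g).

(** The dual of precomposition with [f]. It sends evaluation at [x] to evaluation at [f x], so its
    restriction to the closures is the extension of [f] to the Cech-Stone compactifications. *)
Definition cube_map (q : {ptws @unit_functions R S -> R}) :
  {ptws @unit_functions R T -> R} := fun g => q (unit_comp g).

Lemma cube_map_continuous : continuous cube_map.
Proof.
apply: (@continuous_ptws {ptws @unit_functions R S -> R} R) => g q.
exact: (@proj_continuous _ (fun=> R) (unit_comp g)).
Qed.

Lemma cube_map_closure (p : stone_cech R S) :
  cube_map (val p) \in closure (range (@evaluation R T)).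
Proof.
have := valP p; rewrite !inE => cp B /cube_map_continuous/cp.
by move=> -[_ [[x _ <-] Bx]]; exists (evaluation (f x)); split => //; exists (f x).
Qed.

Definition stone_cech_map (p : stone_cech R S) : stone_cech R T :=
  exist _ (cube_map (val p)) (cube_map_closure p).

Lemma stone_cech_map_unit (x : S) :
  stone_cech_map (to_stone_cech R x) = to_stone_cech R (f x).
Proof. exact: val_inj. Qed.

Lemma stone_cech_map_continuous : continuous stone_cech_map.
Proof.
apply/continuousP => A [B oB <-].
have /continuousP := @cube_map_continuous => /(_ B oB) oB'.
by exists (cube_map @^-1` B).
Qed.

Lemma stone_cech_map_closure (A : set S) p :
  closure (to_stone_cech R @` A) p ->
  closure (to_stone_cech R @` (f @` A)) (stone_cech_map p).
Proof.
move=> cp B /stone_cech_map_continuous/cp [_ [[x Ax <-] Bx]].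
exists (to_stone_cech R (f x)); split; first by exists (f x) => //; exists x.
by rewrite -stone_cech_map_unit.
Qed.

Lemma stone_cech_map_closed (C : set (stone_cech R S)) :
  closed C -> closed (stone_cech_map @` C).
Proof.
move=> cC; apply: compact_closed; first exact: stone_cech_hausdorff.
apply: continuous_compact; last first.
  by apply: (subclosed_compact cC (@stone_cech_compact R S)).
by apply: continuous_subspaceT => x; exact: stone_cech_map_continuous.
Qed.

Lemma stone_cech_map_onto r :
  closure (to_stone_cech R @` range f) r -> exists p, stone_cech_map p = r.
Proof.
move=> cr; suff : range stone_cech_map r by case=> p _ <-; exists p.
have /closure_id -> : closed (range stone_cech_map).
  by apply: stone_cech_map_closed; exact: closedT.
move: cr; apply: closureS => _ [_ [x _ <-] <-].
by exists (to_stone_cech R x) => //; exact: stone_cech_map_unit.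
Qed.

(** The image of the complement of [O] is closed, by compactness, and misses [r]; its complement
    serves as [N]. *)
Lemma stone_cech_map_tube r (O : set (stone_cech R S)) :
  open O -> (forall p, stone_cech_map p = r -> O p) ->
  exists2 N, nbhs r N & forall p, N (stone_cech_map p) -> O p.
Proof.
move=> oO rO; exists (~` (stone_cech_map @` ~` O)).
  apply: open_nbhs_nbhs; split.
    by apply: closed_openC; apply: stone_cech_map_closed; exact: open_closedC.
  by move=> [p nOp /rO].
by move=> p Np; apply: contrapT => nOp; apply: Np; exists p.
Qed.

End StoneCechMap.

(** * Closures in the Cech-Stone compactification and points avoiding nowhere dense sets *)

Section StoneCechSpace.
Variables (R : realType) (T : topologicalType).
Implicit Types (p : stone_cech R T) (A : set T).

Lemma stone_cech_regular p (O : set (stone_cech R T)) : nbhs p O ->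
  exists B, [/\ nbhs p B, closed B & B `<=` O].
Proof.
move=> pO.
have [|B pB BO] := @compact_regular _ p setT (@stone_cech_hausdorff R T)
  (@stone_cech_compact R T) _ O pO; first exact: filterT.
exists (closure B); split => //; first exact: filterS (@subset_closure _ B) pB.
exact: closed_closure.
Qed.

Lemma preimage_unit_closed (C : set (stone_cech R T)) :
  closed C -> closed (to_stone_cech R @^-1` C).
Proof.
by move=> cC; apply: preimage_closed => // x _; exact: to_stone_cech_continuous.
Qed.

Lemma closure_unit_trace p (N : set (stone_cech R T)) A :
  nbhs p N -> closure (to_stone_cech R @` A) p ->
  closure (to_stone_cech R @` (A `&` to_stone_cech R @^-1` N)) p.
Proof.
move=> pN pA B pB; have [_ [[x Ax <-] [Nx Bx]]] := pA _ (filterI pN pB).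
by exists (to_stone_cech R x); split => //; exists x.
Qed.

Lemma closure_unit_preimage p (N : set (stone_cech R T)) :
  nbhs p N -> closure (to_stone_cech R @` (to_stone_cech R @^-1` N)) p.
Proof.
move=> pN; have -> : to_stone_cech R @^-1` N =
  setT `&` to_stone_cech R @^-1` N by rewrite setTI.
apply: closure_unit_trace => // B pB.
have [|y [By [x _ xy]]] := @to_stone_cech_dense R T (interior B) _
  (open_interior B).
  by exists p; exact: pB.
exists y; split; last exact: interior_subset.
by exists x.
Qed.

Lemma closure_unit_closure A :
  closure (to_stone_cech R @` closure A) `<=` closure (to_stone_cech R @` A).
Proof.
rewrite [X in _ `<=` X](closure_id _).1; last exact: closed_closure.
apply: closureS => _ [x clx <-] B /to_stone_cech_continuous/clx.
by move=> [y [Ay By]]; exists (to_stone_cech R y); split => //; exists y.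
Qed.

(** The extension of [f] to the compactification is constantly 0 on the closure of [A] and 1 on that
    of [B]. *)
Lemma closure_unit_separated A (B : set T) (f : T -> R) p : continuous f ->
  range f `<=` `[0%R, 1%R] -> (forall x, A x -> f x = 0%R) ->
  (forall x, B x -> f x = 1%R) ->
  closure (to_stone_cech R @` A) p -> ~ closure (to_stone_cech R @` B) p.
Proof.
move=> cf f01 f0 f1 pA pB.
have [g cg gf] := @unit_function_extends R T f cf f01.
have gcst (C : set T) (a : R) : (forall x, C x -> f x = a) ->
    closure (to_stone_cech R @` C) p -> g p = a.
  move=> fa pC; suff /closure_id E : closed (g @^-1` [set a]).
    suff : (g @^-1` [set a]) p by [].
    rewrite E; move: pC; apply: closureS => _ [x Cx <-].
    by have := congr1 (@^~ x) gf => /= ->; exact: fa.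
  by apply: preimage_closed; [move=> ? _; exact: cg|exact: closed_eq].
by have := oner_neq0 R; rewrite -(gcst _ _ f1 pB) (gcst _ _ f0 pA) eqxx.
Qed.

Lemma closure_unit_disjoint A (B : set T) p : normal_space T -> closed A ->
  closed B -> A `&` B = set0 -> closure (to_stone_cech R @` A) p ->
  ~ closure (to_stone_cech R @` B) p.
Proof.
move=> nT cA cB AB.
have /(@uniform_separatorP _ R)[f [cf f01 f0 f1]] : uniform_separator A B.
  by apply: (proj1 (@normal_separatorP R T)).
apply: (@closure_unit_separated _ _ f) => // x ?; [apply: f0|apply: f1].
all: by exists x.
Qed.

(* The remote points, except that they are not required to lie in the remainder:
   this is automatic when singletons are nowhere dense. *)
Definition avoiding : set (stone_cech R T) :=
  [set p | forall A, nowhere_dense A -> ~ closure (to_stone_cech R @` A) p].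

Lemma nowhere_dense_closure A : nowhere_dense A -> nowhere_dense (closure A).
Proof.
by move=> nA; rewrite /nowhere_dense -(closure_id _).1 //; exact: closed_closure.
Qed.

(** A singleton with non-empty interior would be a compact neighborhood of its point. So singletons
    are nowhere dense, and avoiding them forces a point into the remainder. *)
Lemma remote_pointsE : hausdorff_space T -> nowhere_locally_compact T ->
  remote_points R T = avoiding.
Proof.
move=> hT nlT; apply/seteqP; split=> [p [_ //]|p ap]; split => // -[x _ xp].
have /ap : nowhere_dense [set x].
  rewrite /nowhere_dense -(closure_id _).1; last first.
    exact/accessible_closed_set1/hausdorff_accessible.
  rewrite -subset0 => y xy.
  have yx : y = x := interior_subset xy.
  by rewrite yx in xy; exact: (nlT x [set x] (@compact_set1 _ x) xy).
by apply; apply: subset_closure; exists x.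
Qed.

(* Near [p] the closure of [V] and the complement of [V] are disjoint, since they
   meet in the boundary of [V], which [p] avoids. *)
Lemma avoiding_open p (V : set T) : normal_space T -> open V -> avoiding p ->
  closure (to_stone_cech R @` V) p -> ~ closure (to_stone_cech R @` ~` V) p.
Proof.
move=> nT oV ap pV pCV.
pose N := closure V `&` ~` V.
have cN : closed N by apply: closedI; [exact: closed_closure|exact: open_closedC].
have nN : nowhere_dense N.
  rewrite /nowhere_dense -(closure_id _).1 //; rewrite -subset0 => y Ny.
  have [cVy nVy] := interior_subset Ny.
  by have [z [Vz /interior_subset[]]] := cVy _ (nbhs_interior Ny).
have [B [pB cB BN]] : exists B, [/\ nbhs p B, closed B &
    B `<=` ~` closure (to_stone_cech R @` N)].
  apply: stone_cech_regular; apply: open_nbhs_nbhs; split; last exact: ap.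
  exact/closed_openC/closed_closure.
apply: (@closure_unit_disjoint (closure V `&` to_stone_cech R @^-1` B)
  (~` V `&` to_stone_cech R @^-1` B) p) => //.
- by apply: closedI; [exact: closed_closure|exact: preimage_unit_closed].
- by apply: closedI; [exact: open_closedC|exact: preimage_unit_closed].
- rewrite -subset0 => x [[cVx Bx] [nVx _]]; apply: (BN _ Bx).
  by apply: subset_closure; exists x.
- apply: closure_unit_trace => //; move: pV; apply: closureS.
  by apply: image_subset; exact: subset_closure.
- exact: closure_unit_trace.
Qed.

End StoneCechSpace.

(** * Closed irreducible maps *)

(* A closed irreducible map onto the closure of [V]. *)
Record resolution (Z X : topologicalType) (V : set X) (f : Z -> X) : Prop :=
  Resolution {
    resolution_continuous : continuous f;
    resolution_closed : forall A, closed A -> closed (f @` A);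
    resolution_sub : range f `<=` closure V;
    resolution_onto : V `<=` range f;
    resolution_irreducible : forall O : set Z, open O -> O !=set0 ->
      exists W, [/\ open W, W !=set0, W `<=` V & f @^-1` W `<=` O] }.

Section Resolution.
Variables (R : realType) (Z X : topologicalType) (V : set X) (f : Z -> X).
Hypotheses (nX : normal_space X) (oV : open V) (rf : resolution V f).

Let cf := resolution_continuous rf.
Let bf := @stone_cech_map R Z X f cf.

(** If the closure of the preimage has interior, irreducibility gives an open [W] whose points are
    images of points of that closure; by continuity [W] lies in the closure of [A]. *)
Lemma resolution_preimage_nowhere_dense (A : set X) :
  nowhere_dense A -> nowhere_dense (f @^-1` A).
Proof.
move=> nA; rewrite /nowhere_dense -subset0 => z zO.
have [|W [oW [w Ww] WV fW]] := resolution_irreducible rf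
  (open_interior (closure (f @^-1` A))); first by exists z.
have : interior (closure A) w.
  rewrite /interior /= nbhsE; exists W => // y /[dup] Wy.
  move=> /WV /(resolution_onto rf)[u _ fu].
  have /interior_subset cu : (closure (f @^-1` A))° u.
    by apply: fW; rewrite /preimage /= fu.
  move=> B; rewrite -fu => /cf /cu [v [Av Bv]]; by exists (f v).
by rewrite nA.
Qed.

(** Otherwise irreducibility, applied to the part of the preimage outside [A], yields a point of [W]
    whose whole fibre misses [A], although [W] is covered by the image of [A]. *)
Lemma resolution_image_interior (A : set Z) (W : set X) : closed A ->
  open W -> W !=set0 -> W `<=` f @` A ->
  (W `&` V) !=set0 /\ f @^-1` (W `&` V) `<=` A.
Proof.
move=> cA oW [w Ww] WA.
have [a Aa faw] := WA _ Ww.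
have cVw : closure V w by apply: (resolution_sub rf); rewrite -faw; exists a.
have [v [Vv Wv]] := cVw W (open_nbhs_nbhs (conj oW Ww)).
split; first by exists v.
move=> z Wz; apply: contrapT => nAz.
have [||W' [oW' [w' Ww'] WV' fW']] :=
    resolution_irreducible rf (O := f @^-1` (W `&` V) `&` ~` A).
- apply: openI; last exact: closed_openC.
  by apply: open_comp; [move=> *; exact: cf|exact: openI].
- by exists z.
have [u _ fu] := resolution_onto rf (WV' _ Ww').
have [[Wu _] _] : (f @^-1` (W `&` V) `&` ~` A) u.
  by apply: fW'; rewrite /preimage /= fu.
have [b Ab fb] := WA _ Wu.
have [_] : (f @^-1` (W `&` V) `&` ~` A) b by apply: fW'; rewrite /preimage /= fb fu.
exact.
Qed.

Lemma resolution_image_nowhere_dense (A : set Z) :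
  closed A -> nowhere_dense A -> nowhere_dense (f @` A).
Proof.
move=> cA nA; rewrite /nowhere_dense -(closure_id _).1; last first.
  exact: resolution_closed rf _ cA.
rewrite -subset0 => x xA.
have [||] := resolution_image_interior cA (open_interior (f @` A)).
- by exists x.
- exact: interior_subset.
move=> [w WVw] WA; have [u _ fu] := resolution_onto rf WVw.2.
suff : interior (closure A) u by rewrite nA.
rewrite -(closure_id _).1 // /interior /= nbhsE.
exists (f @^-1` ((f @` A)° `&` V)) => //; split.
  apply: open_comp; first by move=> *; exact: cf.
  by apply: openI => //; exact: open_interior.
by rewrite /preimage /= fu.
Qed.

(** A non-empty open set inside both images would, once intersected with [V], have its preimage in
    both [A] and [B]. *)
Lemma resolution_disjoint_images (A B : set Z) : closed A -> closed B ->
  A `&` B = set0 -> nowhere_dense (f @` A `&` f @` B).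
Proof.
move=> cA cB AB; have cfA := resolution_closed rf cA.
have cfB := resolution_closed rf cB.
rewrite /nowhere_dense -(closure_id _).1; last exact: closedI.
rewrite -subset0 => x xN.
have oN := open_interior (f @` A `&` f @` B).
have nN : (f @` A `&` f @` B)° !=set0 by exists x.
have [|[w WVw] WA] := resolution_image_interior cA oN nN.
  by move=> y /interior_subset[].
have [|_ WB] := resolution_image_interior cB oN nN.
  by move=> y /interior_subset[].
have [u _ fu] := resolution_onto rf WVw.2.
have : (A `&` B) u by split; [apply: WA|apply: WB]; rewrite /preimage /= fu.
by rewrite AB.
Qed.

(** Some closed neighborhood of [p] has a trace on [Z] disjoint from the preimage of the closure of
    [A]. The image of this trace is closed and disjoint from the closure of [A], so by normality the
    two have disjoint closures in the compactification. *)
Lemma resolution_avoiding p : avoiding p -> avoiding (bf p).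
Proof.
move=> ap A nA pA.
have nA' := nowhere_dense_closure nA.
have nfA := resolution_preimage_nowhere_dense nA'.
have [B [pB cB BN]] : exists B, [/\ nbhs p B, closed B &
    B `<=` ~` closure (to_stone_cech R @` (f @^-1` closure A))].
  apply: stone_cech_regular; apply: open_nbhs_nbhs; split; last exact: ap.
  exact/closed_openC/closed_closure.
apply: (@closure_unit_disjoint R X (f @` (to_stone_cech R @^-1` B)) (closure A)
  (bf p)) => //.
- by apply: (resolution_closed rf); exact: preimage_unit_closed.
- exact: closed_closure.
- rewrite -subset0 => _ [[x Bx <-] Afx]; apply: (BN _ Bx).
  by apply: subset_closure; exists x.
- apply: stone_cech_map_closure; exact: closure_unit_preimage.
- move: pA; apply: closureS; apply: image_subset; exact: subset_closure.
Qed.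

Lemma resolution_avoiding_preimage p : avoiding (bf p) -> avoiding p.
Proof.
move=> ap A nA pA; have nA' := nowhere_dense_closure nA.
apply: (ap (f @` closure A)).
  by apply: resolution_image_nowhere_dense => //; exact: closed_closure.
apply: stone_cech_map_closure; move: pA; apply: closureS.
by apply: image_subset; exact: subset_closure.
Qed.

(** Disjoint closed neighborhoods of two preimages have traces whose images meet in a nowhere dense
    set. The common image avoids this set, so near it the two images are disjoint closed sets, yet
    both have it in their closure. *)
Lemma resolution_avoiding_inj p q : avoiding (bf p) -> bf p = bf q -> p = q.
Proof.
move=> ap pq; apply: contrapT => npq.
have := @stone_cech_hausdorff R Z; rewrite open_hausdorff => /(_ p q).
move=> /(_ (introN eqP npq)) [] [] O O' /= [/set_mem Op /set_mem Oq].
move=> [oO oO' /eqP OO].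
have [B [pB cB BO]] := stone_cech_regular (open_nbhs_nbhs (conj oO Op)).
have [B' [qB cB' BO']] := stone_cech_regular (open_nbhs_nbhs (conj oO' Oq)).
pose G := to_stone_cech R @^-1` B; pose H := to_stone_cech R @^-1` B'.
have cG : closed G by exact: preimage_unit_closed.
have cH : closed H by exact: preimage_unit_closed.
have nN : nowhere_dense (f @` G `&` f @` H).
  apply: resolution_disjoint_images => //.
  rewrite -subset0 => x [/BO Ox /BO' Ox'].
  by have : (O `&` O') (to_stone_cech R x) by []; rewrite OO.
have [D [pD cD DN]] : exists D, [/\ nbhs (bf p) D, closed D &
    D `<=` ~` closure (to_stone_cech R @` (f @` G `&` f @` H))].
  apply: stone_cech_regular; apply: open_nbhs_nbhs; split; last exact: ap.
  exact/closed_openC/closed_closure.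
apply: (@closure_unit_disjoint R X (f @` G `&` to_stone_cech R @^-1` D)
  (f @` H `&` to_stone_cech R @^-1` D) (bf p)) => //.
- apply: closedI; last exact: preimage_unit_closed.
  exact: resolution_closed rf _ cG.
- apply: closedI; last exact: preimage_unit_closed.
  exact: resolution_closed rf _ cH.
- rewrite -subset0 => x [[Gx Dx] [Hx _]]; apply: (DN _ Dx).
  by apply: subset_closure; exists x.
- apply: closure_unit_trace => //; apply: stone_cech_map_closure.
  exact: closure_unit_preimage.
- rewrite pq in pD *; apply: closure_unit_trace => //.
  apply: stone_cech_map_closure; exact: closure_unit_preimage.
Qed.

Lemma resolution_closure p : closure (to_stone_cech R @` V) (bf p).
Proof.
apply: closure_unit_closure.
have pT : nbhs p setT by exact: filterT.
move: (@stone_cech_map_closure R Z X f cf _ _ (closure_unit_preimage pT)).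
apply: closureS; apply: image_subset.
by move=> _ [x _ <-]; apply: (resolution_sub rf); exists x.
Qed.

Lemma resolution_lift r : closure (to_stone_cech R @` V) r ->
  exists p, bf p = r.
Proof.
move=> cr; apply: stone_cech_map_onto; move: cr; apply: closureS.
by apply: image_subset; exact: resolution_onto rf.
Qed.

(** The fibre of [bf p] is the single point [p], so the tube property of closed maps applies. This
    is the continuity of the inverse of [bf] on avoiding points. *)
Lemma resolution_tube p (O : set (stone_cech R Z)) : avoiding (bf p) ->
  nbhs p O -> exists2 N, nbhs (bf p) N & forall q, N (bf q) -> O q.
Proof.
rewrite nbhsE => ap [U [oU Up] UO].
have [|N pN NU] := @stone_cech_map_tube R Z X f cf (bf p) U oU.
  by move=> q qp; rewrite -(@resolution_avoiding_inj p q).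
by exists N => // q /NU /UO.
Qed.

End Resolution.

(** * Remote points of Baire spaces *)

(** The power of a discrete [K], under its own name so that it can carry the topology defined below,
    in which the sets [agree n z] are the basic neighborhoods of [z]. *)
Definition baire_space (K : Type) : Type := nat -> K.

HB.instance Definition _ (K : Type) := gen_eqMixin (baire_space K).
HB.instance Definition _ (K : Type) := gen_choiceMixin (baire_space K).

Section BaireTopology.
Variable K : Type.
Implicit Types (z : baire_space K) (s : seq K) (n : nat).

Definition agree n z z' := forall i, (i < n)%N -> z i = z' i.

Definition cylinder s : set (baire_space K) := [set z | mkseq z (size s) = s].

Lemma agreeW m n z z' : (m <= n)%N -> agree n z z' -> agree m z z'.
Proof. by move=> mn zz i im; apply: zz; exact: leq_trans im mn. Qed.

Lemma agree_mkseq n z z' : agree n z z' -> mkseq z n = mkseq z' n.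
Proof. by move=> zz; apply/eq_in_map => i; rewrite mem_iota => /zz. Qed.

Lemma mkseq_agree n z z' : mkseq z n = mkseq z' n -> agree n z z'.
Proof.
by move=> zz i il; have := congr1 (fun s => nth (z i) s i) zz; rewrite !nth_mkseq.
Qed.

Lemma cylinder_agree n s z z' : (size s <= n)%N -> agree n z z' ->
  cylinder s z -> cylinder s z'.
Proof. by move=> sn /(agreeW sn) /agree_mkseq; rewrite /cylinder /= => ->. Qed.

Definition baire_open : set (set (baire_space K)) :=
  [set U | forall z, U z -> exists n, agree n z `<=` U].

Lemma baire_openT : baire_open setT.
Proof. by move=> z _; exists 0%N. Qed.

Lemma baire_openI : setI_closed baire_open.
Proof.
move=> U V oU oV z [/oU[m mU] /oV[n nV]]; exists (maxn m n) => z' zz; split.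
  by apply: mU; apply: agreeW zz; exact: leq_maxl.
by apply: nV; apply: agreeW zz; exact: leq_maxr.
Qed.

Lemma baire_open_bigcup (I : Type) (U : I -> set (baire_space K)) :
  (forall i, baire_open (U i)) -> baire_open (\bigcup_i U i).
Proof.
by move=> oU z [i _ /oU[n nU]]; exists n => z' /nU Uz; exists i.
Qed.

HB.instance Definition _ := isOpenTopological.Build (baire_space K)
  baire_openT baire_openI baire_open_bigcup.

Lemma baire_openE (U : set (baire_space K)) :
  open U = (forall z, U z -> exists n, agree n z `<=` U).
Proof. by []. Qed.

Lemma nbhs_agree z n : nbhs z (agree n z).
Proof.
rewrite nbhsE; exists (agree n z) => //; split=> //.
rewrite baire_openE => z' zz'; exists n => z'' zz'' i il.
by rewrite zz' // zz''.
Qed.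

Lemma open_cylinder s : open (cylinder s).
Proof.
rewrite baire_openE => z sz; exists (size s) => z1 zz.
exact: cylinder_agree zz sz.
Qed.

Lemma cylinder_nonempty (k : K) s : exists z, cylinder s z.
Proof. by exists (fun i => nth k s i); rewrite /cylinder /= mkseq_nth. Qed.

Lemma cylinder_base (U : set (baire_space K)) z : open U -> U z ->
  exists n, cylinder (mkseq z n) `<=` U.
Proof.
rewrite baire_openE => oU /oU[n nU]; exists n => z'.
by rewrite /cylinder /= size_mkseq => /esym/mkseq_agree/nU.
Qed.

End BaireTopology.

(** * Van Douwen's linked sets and avoiding points in every cylinder *)

Section BaireRemote.
Variables (R : realType) (K : Type) (iota : nat -> K).
Hypothesis iota_inj : injective iota.
Implicit Types (z : baire_space K) (s t : seq K) (n : nat).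

Lemma nowhere_dense_avoids (A : set (baire_space K)) : nowhere_dense A ->
  exists e : seq K -> seq K,
    forall s, cylinder (e s) `<=` cylinder s /\ cylinder (e s) `&` A = set0.
Proof.
move=> nA; suff /choice[e eP] : forall s, exists t,
  cylinder t `<=` cylinder s /\ cylinder t `&` A = set0 by exists e.
move=> s; have [z0 sz0] := cylinder_nonempty (iota 0) s.
have [z [sz nz]] : exists z, cylinder s z /\ ~ closure A z.
  apply: contrapT => h; suff : interior (closure A) z0 by rewrite nA.
  rewrite /interior /= nbhsE; exists (cylinder s).
    by split=> //; exact: open_cylinder.
  by move=> z sz; apply: contrapT => nz; apply: h; exists z.
have [||n nU] := @cylinder_base _ (cylinder s `&` ~` closure A) z.
- apply: openI; first exact: open_cylinder.
  exact/closed_openC/closed_closure.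
- by [].
exists (mkseq z n); split; first by move=> z' /nU[].
by rewrite -subset0 => z' [/nU[_ nz'] Az']; apply: nz'; exact: subset_closure.
Qed.

(* Van Douwen's linked families: [e] shrinks each cylinder [s] to a cylinder
   [e s] missing a given nowhere dense set. The sets [linked n e t] for [n]
   functions [e] meet: pick the one with [size (e t)] least and recurse in the
   cylinder [e t]. *)
Fixpoint linked n (e : seq K -> seq K) t z : Prop :=
  if n is m.+1 then cylinder (e t) z \/
    (cylinder t z /\ exists2 i, (i <= size (e t))%N & linked m e (mkseq z i) z)
  else False.

Lemma linked_avoids n (e : seq K -> seq K) (A : set (baire_space K)) t z :
  (forall s, cylinder (e s) `&` A = set0) -> linked n e t z -> ~ A z.
Proof.
move=> eA; elim: n t z => [//|n IH] t z /= [tz Az|[_ [i _]]]; last exact: IH.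
by have : (cylinder (e t) `&` A) z by []; rewrite eA.
Qed.

(** Only finitely many coordinates of [z] are inspected, because the prefixes tried at each level
    have bounded length. Hence the linked sets are clopen. *)
Lemma linked_local n (e : seq K -> seq K) t z : exists N, forall z',
  agree N z z' -> (linked n e t z <-> linked n e t z').
Proof.
elim: n t z => [|n IH] t z; first by exists 0%N.
have [N NP] : exists N, forall z', agree N z z' -> forall i,
    (i <= size (e t))%N ->
    (linked n e (mkseq z i) z <-> linked n e (mkseq z' i) z').
  elim: (size (e t)) => [|m [N NP]].
    have [N NP] := IH [::] z; exists N => z' /NP zz' i.
    by rewrite leqn0 => /eqP ->.
  have [N' NP'] := IH (mkseq z m.+1) z; exists (maxn m.+1 (maxn N N')) => z' zz i.
  have zzm : agree m.+1 z z' by apply: agreeW zz; exact: leq_maxl.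
  rewrite leq_eqVlt => /orP[/eqP ->|im].
    rewrite -(agree_mkseq zzm); apply: NP'; apply: agreeW zz.
    by rewrite !leq_max leqnn !orbT.
  apply: NP => //; apply: agreeW zz.
  by rewrite !leq_max leqnn orbT.
exists (maxn N (maxn (size t) (size (e t)))) => z' zz /=.
have zzN : agree N z z' by apply: agreeW zz; exact: leq_maxl.
have zzt : agree (size t) z z'.
  by apply: agreeW zz; rewrite !leq_max leqnn orbT.
have zze : agree (size (e t)) z z'.
  by apply: agreeW zz; rewrite !leq_max leqnn !orbT.
rewrite /cylinder /= (agree_mkseq zzt) (agree_mkseq zze).
split=> -[|[? [i il h]]]; do ?[by left]; right; split=> //; exists i => //.
  by apply/(NP z').
by apply/(NP z').
Qed.

Lemma linked_meet n (I : eqType) (e : I -> seq K -> seq K) (l : seq I) t :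
  (forall i, i \in l -> forall s, cylinder (e i s) `<=` cylinder s) ->
  (size l <= n)%N ->
  exists z, cylinder t z /\ forall i, i \in l -> linked n (e i) t z.
Proof.
elim: n l t => [|n IH] l t el.
  rewrite leqn0 size_eq0 => /eqP ->.
  by have [z tz] := cylinder_nonempty (iota 0) t; exists z.
have [->|l0] := eqVneq l [::].
  by have [z tz] := cylinder_nonempty (iota 0) t; exists z.
have [a al amin] : exists2 a, a \in l &
    forall b, b \in l -> (size (e a t) <= size (e b t))%N.
  elim: l l0 {el IH} => // x [|y l] IHl _.
    by exists x; rewrite ?mem_head // => b; rewrite inE => /eqP ->.
  have [//|a al amin] := IHl.
  have [xa|ax] := leqP (size (e x t)) (size (e a t)).
    exists x; first exact: mem_head.
    move=> b; rewrite inE => /orP[/eqP -> //|/amin]; exact: leq_trans.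
  exists a; first by rewrite inE al orbT.
  by move=> b; rewrite inE => /orP[/eqP ->|/amin //]; exact: ltnW.
move=> ln; have [||z [az lz]] := IH (rem a l) (e a t).
- by move=> i /mem_rem; exact: el.
- by rewrite size_rem //; case: (size l) ln.
have tz : cylinder t z by exact: (el a al t z az).
exists z; split=> // i il.
have : i \in a :: rem a l by rewrite -(perm_mem (perm_to_rem al)).
rewrite inE => /orP[/eqP ->|/lz iz]; first by left.
(* The prefix of [z] of this length is [e a t], where the induction hypothesis has linked the
   remaining members; minimality makes the length admissible for [e i]. *)
right; split=> //; exists (size (e a t)); first exact: amin.
by move: az; rewrite /cylinder /= => ->.
Qed.

Lemma locally_constant_indicator (P : baire_space K -> Prop) :
  (forall z, exists N, forall z', agree N z z' -> (P z <-> P z')) ->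
  continuous (fun z => if pselect (P z) then 1%R else 0%R : R).
Proof.
move=> Ploc z A; have [N NP] := Ploc z => zA.
apply: (@filterS _ (nbhs z) _ (agree N z)); last exact: nbhs_agree.
move=> z' /NP PP; rewrite /preimage /=.
suff -> : (if pselect (P z') then 1%R else 0%R : R) =
  (if pselect (P z) then 1%R else 0%R) by exact: nbhs_singleton zA.
case: pselect => h; case: pselect => h' //.
  by case: h'; apply/PP.
by case: h; apply/PP.
Qed.

(** For each nowhere dense [A] there is a clopen set [F A] in the cylinder that misses [A]. These
    sets have the finite intersection property, and [p] is a point in all their closures. *)
Lemma avoiding_cylinder s : exists p : stone_cech R (baire_space K),
  avoiding p /\ closure (to_stone_cech R @` cylinder s) p.
Proof.
have /choice[e eP] : forall A : set (baire_space K), exists e : seq K -> seq K,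
    nowhere_dense A ->
    forall s, cylinder (e s) `<=` cylinder s /\ cylinder (e s) `&` A = set0.
  move=> A; have [/nowhere_dense_avoids[e eP]|nA] := pselect (nowhere_dense A).
    by exists e.
  by exists id.
(* On the child of [s] labelled [iota n], [F A] is the [n]-linked set of [e A]. Any [n] of these
   sets, for nowhere dense [A], meet inside that child, so finitely many always meet. Injectivity of
   [iota] makes [n] a function of [z]. *)
pose F A z := cylinder s z /\ exists2 n, z (size s) = iota n &
  linked n (e A) (mkseq z (size s).+1) z.
have Floc A z : exists N, forall z', agree N z z' -> (F A z <-> F A z').
  have [[n zn]|nz] := pselect (exists n, z (size s) = iota n).
    have [N NP] := linked_local n (e A) (mkseq z (size s).+1) z.
    exists (maxn N (size s).+1) => z' zz.
    have zzN : agree N z z' by apply: agreeW zz; exact: leq_maxl.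
    have zzs : agree (size s).+1 z z' by apply: agreeW zz; exact: leq_maxr.
    have z'n : z' (size s) = iota n by rewrite -zzs.
    have cs := agree_mkseq (agreeW (leqnSn _) zzs).
    have cs' := agree_mkseq zzs.
    rewrite /F /cylinder /= cs -cs'; split=> -[? [m]].
      by rewrite zn => /iota_inj <- /(NP _ zzN) ?; split=> //; exists n.
    by rewrite z'n => /iota_inj <- /(NP _ zzN) ?; split=> //; exists n.
  exists (size s).+1 => z' zz; have zs : z' (size s) = z (size s) by rewrite zz.
  split=> -[_ [n zn _]]; first by case: nz; exists n.
  by case: nz; exists n; rewrite -zs.
(* The filter generated by the cylinder of [s] and all [F A] with [A] nowhere dense; [p] will be a
   cluster point of its image. *)
pose G := [set B | exists2 l : seq (set (baire_space K)),
  (forall A, A \in l -> nowhere_dense A) &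
  forall z, cylinder s z -> (forall A, A \in l -> F A z) -> B z].
have Gl (l : seq (set (baire_space K))) :
    (forall A, A \in l -> nowhere_dense A) ->
    exists z, cylinder s z /\ forall A, A \in l -> F A z.
  move=> nl; pose t := rcons s (iota (size l)).
  have [|//|z [tz zP]] := @linked_meet (size l) _ e l t.
    by move=> A /nl/eP eA u; have [] := eA u.
  have [zs zt] : cylinder s z /\ z (size s) = iota (size l).
    move: tz; rewrite /cylinder /= size_rcons -[in mkseq _ _]addn1 /mkseq iotaD.
    rewrite map_cat /= add0n cats1 => /rcons_inj[]; split=> //.
  exists z; split=> // A Al; split=> //; exists (size l) => //.
  move: tz; rewrite /cylinder /= size_rcons => ->; exact: zP.
have FG : ProperFilter G.
  split; first by move=> [l /Gl[z [sz zl]] /(_ z sz zl)].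
  split; first by exists [::].
    move=> B C [l nl lB] [l' nl' lC]; exists (l ++ l').
      by move=> A; rewrite mem_cat => /orP[/nl|/nl'].
    move=> z sz zl; split; [apply: lB|apply: lC] => // A Al; apply: zl.
      by rewrite mem_cat Al.
    by rewrite mem_cat Al orbT.
  by move=> B C BC [l nl lB]; exists l => // z sz zl; apply/BC/lB.
have [p [_ Gp]] := @stone_cech_compact R (baire_space K)
  (fmap (to_stone_cech R) G) _ filterT.
exists p; split; last first.
  move=> B; apply: Gp; exists [::] => // z sz _; by exists z.
move=> A nA pA.
(* The indicator of the clopen set [F A] separates it from [A]. *)
apply: (@closure_unit_separated R _ A (F A)
  (fun z => if pselect (F A z) then 1%R else 0%R) p) => //.
- by apply: locally_constant_indicator; exact: Floc.
- move=> _ [z _ <-]; rewrite /= in_itv /=.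
  by case: pselect => h; rewrite ?lexx ler01.
- move=> z Az; case: pselect => // FAz; have [_ [n _ h]] := FAz.
  by case: (linked_avoids (A := A) _ h Az) => u; have [] := eP A nA u.
- by move=> z FAz; case: pselect.
- move=> B; apply: Gp; exists [:: A]; first by move=> C; rewrite inE => /eqP ->.
  by move=> z sz FAz; exists z => //; apply: FAz; rewrite inE.
Qed.

End BaireRemote.

(** * Gluing the pieces *)

Lemma nbhs_set_type (T : topologicalType) (A : set T) (x : A) (B : set A) :
  nbhs x B <-> exists2 C, nbhs (val x) C & val @^-1` C `<=` B.
Proof.
split=> [[_ [[C oC <-] Cx] CB]|[C xC CB]].
  by exists C => //; exact: open_nbhs_nbhs.
have cval : continuous (fun y : A => val y).
  exact: (@initial_continuous _ _ set_val).
by apply: (filterS CB); exact: cval.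
Qed.

(** Stated for a relation so that, applied to the symmetric relation [common_lift], half of the
    conditions follow from the other half with the two spaces exchanged. *)
Lemma homeomorphic_of_relation (S T : topologicalType) (G : S -> T -> Prop) :
  (forall x, exists y, G x y) -> (forall y, exists x, G x y) ->
  (forall x y B, G x y -> nbhs y B ->
     exists2 A, nbhs x A & forall x' y', A x' -> G x' y' -> B y') ->
  (forall x y A, G x y -> nbhs x A ->
     exists2 B, nbhs y B & forall x' y', B y' -> G x' y' -> A x') ->
  (forall x y y', G x y -> G x y' -> y = y') ->
  (forall x x' y, G x y -> G x' y -> x = x') -> homeomorphic S T.
Proof.
move=> /choice[f fG] /choice[g gG] cf cg uf ug.
exists f, g; split.
- by move=> x; exact: (ug _ _ _ (gG _) (fG _)).
- by move=> y; exact: (uf _ _ _ (fG _) (gG _)).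
- move=> x B /(cf _ _ _ (fG x))[A xA AB]; apply: filterS xA => x' Ax'.
  exact: (AB _ _ Ax' (fG x')).
- move=> y A /(cg _ _ _ (gG y))[B yB BA]; apply: filterS yB => y' By'.
  exact: (BA _ _ By' (gG y')).
Qed.

Section Pieces.
Variables (R : realType) (X : topologicalType) (I : Type) (V : I -> set X).
Hypotheses (nX : normal_space X) (hX : hausdorff_space X).
Hypothesis lX : nowhere_locally_compact X.
Hypotheses (oV : forall i, open (V i)) (tV : trivIset setT V).

Definition remote_pieces : set (remote_points R X) :=
  [set r | exists i, closure (to_stone_cech R @` V i) (val r)].

Lemma avoiding_remote (r : remote_points R X) : avoiding (val r).
Proof. by rewrite -remote_pointsE //; have := valP r; rewrite inE. Qed.

Lemma avoiding_piece_inj (p : stone_cech R X) i j :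
  ~ closure (to_stone_cech R @` ~` V i) p ->
  closure (to_stone_cech R @` V j) p -> i = j.
Proof.
move=> npi pj; apply: contrapT => ij; apply: npi; move: pj; apply: closureS.
apply: image_subset => x Vjx Vix; apply: ij; apply: tV => //.
by exists x.
Qed.

Lemma avoiding_piece_nbhs (p : stone_cech R X) i : avoiding p ->
  closure (to_stone_cech R @` V i) p ->
  nbhs p (~` closure (to_stone_cech R @` ~` V i)).
Proof.
move=> ap pi; apply: open_nbhs_nbhs; split.
  exact/closed_openC/closed_closure.
exact: avoiding_open.
Qed.

Lemma closure_unit_complement (p : stone_cech R X) i :
  ~ closure (to_stone_cech R @` ~` V i) p -> closure (to_stone_cech R @` V i) p.
Proof.
move=> np; apply: contrapT => nVp.
have pT : nbhs p setT by exact: filterT.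
have := closure_unit_preimage pT; rewrite preimage_setT -(setUv (V i)).
by rewrite image_setU closureU => -[].
Qed.

(** For a remote point, being in the closure of [V i] amounts to not being in the closure of its
    complement, which is an open condition. *)
Lemma remote_pieces_open : open remote_pieces.
Proof.
rewrite openE => r [i ri]; rewrite /interior /=; apply/nbhs_set_type.
exists (~` closure (to_stone_cech R @` ~` V i)).
  by apply: avoiding_piece_nbhs ri; exact: avoiding_remote.
by move=> r' ?; exists i; exact: closure_unit_complement.
Qed.

Variables (Z : I -> topologicalType) (f : forall i, Z i -> X).
Hypothesis rf : forall i, resolution (V i) (@f i).
Hypothesis aZ : forall i (O : set (Z i)), open O -> O !=set0 ->
  exists p : stone_cech R (Z i),
    avoiding p /\ closure (to_stone_cech R @` O) p.
Hypothesis dV : dense (\bigcup_i V i).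

Let bf i := @stone_cech_map R _ _ (@f i) (resolution_continuous (rf i)).

(** A closed neighborhood inside [O] has an interior whose trace [D] meets some [V i]. An avoiding
    point in the closure of the preimage of [V i] and [D] is mapped to a remote point in that
    neighborhood. *)
Lemma remote_pieces_dense : dense remote_pieces.
Proof.
move=> O [r Or] oO.
have /nbhs_set_type[C rC CO] : nbhs r O by exact: open_nbhs_nbhs.
have [B [rB cB BC]] := stone_cech_regular rC.
pose D := to_stone_cech R @^-1` interior B.
have oD : open D.
  apply: open_comp; last exact: open_interior.
  by move=> *; exact: to_stone_cech_continuous.
have D0 : D !=set0.
  have [|y [By [x _ xy]]] := @to_stone_cech_dense R X (interior B) _
    (open_interior B); first by exists (val r); exact: rB.
  by exists x; rewrite /D /preimage /= xy.
have [x [Dx [i _ Vix]]] := dV D0 oD.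
pose cfi := resolution_continuous (rf i).
have [||p [ap pD]] := aZ (O := @f i @^-1` (V i `&` D)).
- by apply: open_comp; [move=> *; exact: cfi|exact: openI].
- by have [z _ fz] := resolution_onto (rf i) Vix; exists z; rewrite /preimage /= fz.
have rp : (bf p) \in remote_points R X.
  by rewrite inE remote_pointsE //; exact: resolution_avoiding.
exists (exist _ (bf p) rp); split; last by exists i; exact: resolution_closure.
apply: CO; apply: BC; have /closure_id -> := cB.
suff : closure B (bf p) by [].
move: (@stone_cech_map_closure R _ _ _ cfi _ _ pD); apply: closureS.
by move=> _ [_ [z [_ Dz] <-] <-]; exact: interior_subset.
Qed.

End Pieces.

(** * The homeomorphism induced by resolutions with common domains *)

Section Gluing.
Variables (R : realType) (I : Type) (Z : I -> topologicalType).

(** The graph of the homeomorphism: both points are images of one avoiding point of the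
    compactification of some [Z i]. *)
Definition common_lift (X Y : topologicalType)
    (V : I -> set X) (f : forall i, Z i -> X)
    (rf : forall i, resolution (V i) (@f i))
    (W : I -> set Y) (g : forall i, Z i -> Y)
    (rg : forall i, resolution (W i) (@g i))
    (r : stone_cech R X) (q : stone_cech R Y) : Prop :=
  exists i (p : stone_cech R (Z i)), [/\ avoiding p,
    stone_cech_map (resolution_continuous (rf i)) p = r &
    stone_cech_map (resolution_continuous (rg i)) p = q].

Section OneSide.
Variables (X Y : topologicalType) (V : I -> set X) (W : I -> set Y).
Variables (f : forall i, Z i -> X) (g : forall i, Z i -> Y).
Hypotheses (rf : forall i, resolution (V i) (@f i))
  (rg : forall i, resolution (W i) (@g i)).
Hypotheses (nX : normal_space X) (hX : hausdorff_space X)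
  (lX : nowhere_locally_compact X).
Hypotheses (nY : normal_space Y) (hY : hausdorff_space Y)
  (lY : nowhere_locally_compact Y).
Hypotheses (oV : forall i, open (V i)) (tV : trivIset setT V).
Hypothesis oW : forall i, open (W i).

Lemma common_lift_sym r q : common_lift rf rg r q <-> common_lift rg rf q r.
Proof. by split=> -[i [p [? ? ?]]]; exists i, p. Qed.

Lemma common_lift_total (x : remote_pieces V) :
  exists y : remote_pieces W, common_lift rf rg (val (val x)) (val (val y)).
Proof.
have ax := @avoiding_remote R X hX lX (val x).
have [i xi] : remote_pieces V (val x) by have := valP x; rewrite inE.
have [p px] := resolution_lift (rf i) xi.
have ap : avoiding p.
  by apply: (resolution_avoiding_preimage (oV i) (rf := rf i)); rewrite px.
pose q := stone_cech_map (resolution_continuous (rg i)) p.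
have rq : q \in remote_points R Y.
  by rewrite inE remote_pointsE //; exact: resolution_avoiding.
have pq : (exist _ q rq : remote_points R Y) \in remote_pieces W.
  by rewrite inE; exists i; exact: resolution_closure.
by exists (exist _ (exist _ q rq : remote_points R Y) pq), i, p.
Qed.

(** Near [r] only lifts with the same index [i] occur, and the tube property confines them to the
    preimage of [B] under the extension of [g i]. *)
Lemma common_lift_local r i (p : stone_cech R (Z i)) q : avoiding r ->
  stone_cech_map (resolution_continuous (rf i)) p = r ->
  stone_cech_map (resolution_continuous (rg i)) p = q ->
  forall B, nbhs q B -> exists2 A, nbhs r A &
    forall r' q', A r' -> common_lift rf rg r' q' -> B q'.
Proof.
move=> ar pr pq B qB.
have pB : nbhs p (stone_cech_map (resolution_continuous (rg i)) @^-1` B).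
  by apply: stone_cech_map_continuous; rewrite pq.
have [|N rN NB] := resolution_tube nX (oV i) (rf := rf i) _ pB.
  by rewrite pr.
have ri : closure (to_stone_cech R @` V i) r.
  by rewrite -pr; exact: resolution_closure.
exists (N `&` ~` closure (to_stone_cech R @` ~` V i)).
  by apply: filterI; [rewrite -pr|exact: avoiding_piece_nbhs].
move=> r' q' [Nr' nr'] [j [p' [ap' pr' pq']]].
have ij : i = j.
  apply: (avoiding_piece_inj tV nr'); rewrite -pr'; exact: resolution_closure.
subst j; rewrite -pq'; apply: NB; by rewrite pr'.
Qed.

Lemma common_lift_continuous (x : remote_pieces V) (y : remote_pieces W) B :
  common_lift rf rg (val (val x)) (val (val y)) -> nbhs y B ->
  exists2 A, nbhs x A & forall (x' : remote_pieces V) (y' : remote_pieces W),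
    A x' -> common_lift rf rg (val (val x')) (val (val y')) -> B y'.
Proof.
move=> [i [p [ap px py]]] /nbhs_set_type[C /nbhs_set_type[D yD DC] CB].
have ax := @avoiding_remote R X hX lX (val x).
have [A xA AB] := common_lift_local ax px py yD.
exists (val @^-1` (val @^-1` A)).
  apply/nbhs_set_type; exists (val @^-1` A) => //.
  by apply/nbhs_set_type; exists A.
by move=> x' y' Ax' xy; apply: CB; apply: DC; exact: AB xy.
Qed.

Lemma common_lift_unique (x : remote_pieces V) (y y' : remote_pieces W) :
  common_lift rf rg (val (val x)) (val (val y)) ->
  common_lift rf rg (val (val x)) (val (val y')) -> y = y'.
Proof.
move=> [i [p [ap px py]]] [j [p' [ap' px' py']]].
have ax := @avoiding_remote R X hX lX (val x).
have xi : closure (to_stone_cech R @` V i) (val (val x)).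
  by rewrite -px; exact: resolution_closure.
have ij : i = j.
  apply: (avoiding_piece_inj tV (avoiding_open nX (oV i) ax xi)).
  by rewrite -px'; exact: resolution_closure.
subst j; apply: val_inj; apply: val_inj; rewrite -py -py'; congr stone_cech_map.
by by apply: (resolution_avoiding_inj nX (oV i) (rf := rf i)); rewrite px ?px'.
Qed.

End OneSide.

Lemma remote_pieces_homeomorphic (X Y : topologicalType)
    (V : I -> set X) (W : I -> set Y)
    (f : forall i, Z i -> X) (g : forall i, Z i -> Y) :
  (forall i, resolution (V i) (@f i)) -> (forall i, resolution (W i) (@g i)) ->
  normal_space X -> hausdorff_space X -> nowhere_locally_compact X ->
  normal_space Y -> hausdorff_space Y -> nowhere_locally_compact Y ->
  (forall i, open (V i)) -> trivIset setT V ->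
  (forall i, open (W i)) -> trivIset setT W ->
  homeomorphic (@remote_pieces R X I V) (@remote_pieces R Y I W).
Proof.
move=> rf rg nX hX lX nY hY lY oV tV oW tW.
apply: (@homeomorphic_of_relation _ _
  (fun (x : @remote_pieces R X I V) (y : @remote_pieces R Y I W) =>
     common_lift rf rg (val (val x)) (val (val y)))).
- exact: common_lift_total.
- move=> y; have [x yx] := common_lift_total rg rf hY lY nX hX lX oW y.
  by exists x; exact/common_lift_sym.
- by move=> x y B; exact: common_lift_continuous.
- move=> x y A /common_lift_sym yx xA.
  have [B yB BA] := common_lift_continuous nY hY lY oW tW yx xA.
  by exists B => // x' y' By' /common_lift_sym; exact: BA.
- by move=> x y y'; exact: common_lift_unique.
- move=> x x' y /common_lift_sym yx /common_lift_sym; exact: common_lift_unique yx.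
Qed.

End Gluing.

(** * Locally finite families of small open sets *)

Lemma filter_bigcap_finite (T I : Type) (F : set_system T) (D : set I)
    (P : I -> set T) : Filter F -> finite_set D ->
  (forall i, D i -> F (P i)) -> F (\bigcap_(i in D) P i).
Proof.
elim/Pchoice: I => I in D P * => FF /finite_fsetP[A ->] FP.
exact: filter_bigI.
Qed.

Section LocallyFinite.
Variable X : topologicalType.
Implicit Types (I : Type) (x : X).

Definition locally_finite I (U : I -> set X) :=
  forall x, exists2 N, nbhs x N & finite_set [set i | U i `&` N !=set0].

Lemma locally_finite_sub I (U W : I -> set X) :
  (forall i, W i `<=` closure (U i)) -> locally_finite U -> locally_finite W.
Proof.
move=> WU lU x; have [N xN fN] := lU x; exists N°.
  exact: nbhs_interior.
apply: sub_finite_set fN => i [y [/WU Wy Ny]].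
by have [z [Uz Nz]] := Wy _ Ny; exists z.
Qed.

Lemma locally_finite_reindex I J (g : J -> I) (U : I -> set X) :
  injective g -> locally_finite U -> locally_finite (U \o g).
Proof.
move=> gI lU x; have [N xN fN] := lU x; exists N => //.
have := finite_preimage (f := g) _ fN; apply.
by move=> i j _ _; exact: gI.
Qed.

Lemma locally_finite_closure I (U : I -> set X) x : locally_finite U ->
  closure (\bigcup_i U i) x -> exists i, closure (U i) x.
Proof.
move=> lU cx; apply: contrapT => nx.
have [N xN fN] := lU x.
have FN : nbhs x (\bigcap_(i in [set i | U i `&` N !=set0]) ~` closure (U i)).
  apply: filter_bigcap_finite fN _ => i _; apply: open_nbhs_nbhs; split.
    exact/closed_openC/closed_closure.
  by move=> ci; apply: nx; exists i.
have [y [[i _ Uy] [Ny Fy]]] := cx _ (filterI xN FN).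
by apply: (Fy i); [exists y|exact: subset_closure].
Qed.

End LocallyFinite.

(** A complete metric given as a function on [X] itself and inducing its topology, so that metric
    arguments and [stone_cech] concern the same topological space. *)
Record complete_distance (R : realType) (X : topologicalType)
    (d : X -> X -> R) : Prop := CompleteDistance {
  dist_xx : forall x, d x x = 0%R;
  dist_sym : forall x y, d x y = d y x;
  dist_triangle : forall x y z, (d x z <= d x y + d y z)%R;
  dist_eq0 : forall x y, d x y = 0%R -> x = y;
  dist_nbhs : forall x A, nbhs x A <->
    exists2 e : R, (0 < e)%R & forall y, (d x y < e)%R -> A y;
  dist_complete : forall u : nat -> X,
    (forall e, (0 < e)%R -> exists N, forall m n, (N <= m)%N -> (N <= n)%N ->
       (d (u m) (u n) < e)%R) ->
    exists l, forall e, (0 < e)%R -> exists N, forall n, (N <= n)%N ->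
       (d l (u n) < e)%R }.

Lemma completely_metrizable_distance (R : realType) (X : topologicalType) :
  completely_metrizable R X -> exists d : X -> X -> R, complete_distance d.
Proof.
move=> [M [[f [g [fK gK cf cg]]] cM]]; exists (fun x y => mdist (f x) (f y)).
split.
- by move=> x; exact: mdistxx.
- by move=> x y; exact: metric_sym.
- by move=> x y z; exact: metric_triangle.
- by move=> x y /mdist_positivity /(can_inj fK).
- move=> x A; split.
    move=> xA; have : nbhs (f x) (g @^-1` A) by apply: cg; rewrite fK.
    rewrite -nbhs_ballE => -[e e0 eA]; exists e => // y xy.
    by rewrite -[y]fK; apply: eA; rewrite ballEmdist.
  move=> [e e0 eA].
  have : nbhs x (f @^-1` ball (f x) e) by apply: cf; exact: nbhsx_ballx.
  by apply: filterS => y; rewrite /preimage /= ballEmdist; exact: eA.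
- move=> u uC; have [|l ul] := cM (f \o u).
    apply/cauchy_ballP => e e0; have [N NP] := uC e e0.
    exists ((f \o u) @` [set n | (N <= n)%N], (f \o u) @` [set n | (N <= n)%N]).
      by split; exists N => // n Nn; exists n.
    by move=> [_ _] /= [[m Nm <-] [n Nn <-]]; rewrite ballEmdist; exact: NP.
  exists (g l) => e e0; rewrite gK.
  have [N _ NP] := ul _ (nbhsx_ballx l e e0).
  by exists N => n /NP; rewrite /preimage /= ballEmdist.
Qed.

(** * Normality and Stone's construction in a metric space *)

Section Distance.
Variables (R : realType) (X : topologicalType) (d : X -> X -> R).
Hypothesis dP : complete_distance d.
Local Open Scope ring_scope.

Let dxx := dist_xx dP.
Let dC := dist_sym dP.
Let dT := dist_triangle dP.

Lemma dist_ge0 x y : 0 <= d x y.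
Proof. by have := dT x y x; rewrite dxx (dC y x); lra. Qed.

Lemma nbhs_dist x e : 0 < e -> nbhs x [set y | d x y < e].
Proof. by move=> e0; apply/(dist_nbhs dP); exists e. Qed.

Lemma open_distP (A : set X) : open A <->
  forall x, A x -> exists2 e, 0 < e & forall y, d x y < e -> A y.
Proof.
by rewrite openE; split=> h x /h /(dist_nbhs dP).
Qed.

Lemma dist_hausdorff : hausdorff_space X.
Proof.
move=> x y xy; apply: (dist_eq0 dP); apply/eqP; rewrite eq_le dist_ge0 andbT.
rewrite leNgt; apply/negP => xy0.
have e0 : 0 < d x y / 2 by lra.
have [z [/= xz yz]] := xy _ _ (nbhs_dist x e0) (nbhs_dist y e0).
by have := dT x z y; rewrite (dC z y); lra.
Qed.

Lemma dist_normal : normal_space X.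
Proof.
apply/(@normal_openP R) => A B cA cB AB.
(* The union of the balls centred in [C] whose radius is at most half the distance from the centre
   to [D]. *)
pose U (C D : set X) := [set x | exists a e, [/\ C a, d a x < e &
  forall b, D b -> 2 * e <= d a b]].
have oU C D : open (U C D).
  apply/open_distP => x [a [e [Ca ax aD]]]; exists (e - d a x); first lra.
  by move=> y xy; exists a, e; split=> //; have := dT a x y; lra.
have sU C D : closed D -> C `&` D = set0 -> C `<=` U C D.
  move=> cD CD x Cx; have /closed_openC/open_distP/(_ x)[] := cD.
    by move=> Dx; have : (C `&` D) x by []; rewrite CD.
  move=> e e0 eD; exists x, (e / 2); split=> //; first by rewrite dxx; lra.
  move=> b Db; rewrite leNgt; apply/negP => xb; apply: (eD b) => //; lra.
exists (U A B), (U B A); split=> //; [exact: sU|by apply: sU => //; rewrite setIC|].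
rewrite -subset0 => x [[a [e [Aa ax aB]]] [b [e' [Bb bx bA]]]].
have := aB b Bb; have := bA a Aa; have := dT a x b.
by rewrite (dC x b) (dC b a); lra.
Qed.

Definition mesh (n : nat) : R := n.+1%:R^-1.

Lemma mesh_gt0 n : 0 < mesh n.
Proof. by rewrite invr_gt0. Qed.

Lemma mesh_small e : 0 < e -> exists n, mesh n < e.
Proof.
move=> e0; have [N _ NP] := near_infty_natSinv_lt (PosNum e0).
by exists N; apply: NP => /=.
Qed.

Lemma meshW m n : (m <= n)%N -> mesh n <= mesh m.
Proof. by move=> mn; rewrite lef_pV2 ?posrE // ler_nat. Qed.

(* As in the proof of Stone's theorem, well-order [X] and attribute each point to
   the least centre at distance less than [e]; for every [n] the points that are
   [3 * mesh n] inside the ball around their centre form uniformly separated sets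
   [S n x], which are then thickened to [N n x]. *)
Lemma small_disjoint_family (e : R) : 0 < e ->
  exists U : nat * X -> set X,
    [/\ forall i, open (U i),
        forall i j, U i `&` U j !=set0 -> i = j,
        locally_finite U,
        forall i x y, U i x -> U i y -> d x y <= e + e &
        forall W, open W -> W !=set0 -> exists i, W `&` U i !=set0].
Proof.
move=> e0; have [r rW] := @wochoice.well_ordering_principle X.
have rmin (P : set X) : P !=set0 -> exists2 x, P x & forall y, P y -> r x y.
  move=> [x0 Px0]; have [|x [[Px xP] _]] := rW [pred x | `[< P x >]].
    by exists x0; exact/asboolP.
  by exists x; [exact/asboolP|move=> y Py; apply: xP; exact/asboolP].
(* Antisymmetry: both points would be least in the pair, and least elements are unique. *)
have ranti x y : r x y -> r y x -> x = y.
  move=> xy yx; have rr z : r z z.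
    by have [|t -> ] := rmin [set z]; [exists z|apply].
  have [|z [_ zu]] := rW [pred t | (t == x) || (t == y)].
    by exists x; rewrite inE eqxx.
  have -> : x = z.
    by apply/esym/zu; split=> [|t]; rewrite !inE ?eqxx // => /orP[]/eqP ->.
  by apply/zu; split=> [|t]; rewrite !inE ?eqxx ?orbT // => /orP[]/eqP ->.
have /choice[c cP] : forall y, exists x, d x y < e /\ forall z, d z y < e -> r x z.
  move=> y; have [|x xy xm] := rmin [set x | d x y < e].
    by exists y; rewrite /= dxx.
  by exists x.
pose S n x := [set y | c y = x /\ d x y < e - 3 * mesh n].
pose N n x := [set z | exists2 y, S n x y & d y z < mesh n].
(* Points of [S n x] and [S n x'] less than [3 * mesh n] apart lie in the ball around each other's
   centre, so their least centres coincide. The factor 3 pays for two thickenings and one gap. *)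
have NN n x x' z z' : N n x z -> N n x' z' -> d z z' < mesh n -> x = x'.
  move=> [y [<- cy] yz] [y' [<- cy'] yz'] zz.
  have yy : d y y' < 3 * mesh n.
    by have := dT y z y'; have := dT z z' y'; rewrite (dC z' y'); lra.
  apply: ranti; apply: (cP _).2.
    by have := dT (c y') y' y; rewrite (dC y' y); lra.
  by have := dT (c y) y y'; lra.
have oN n x : open (N n x).
  apply/open_distP => z [y Sy yz]; exists (mesh n - d y z); first lra.
  by move=> t zt; exists y => //; have := dT y z t; lra.
have SN y : exists n, d (c y) y < e - 3 * mesh n.
  have [|n nP] := @mesh_small ((e - d (c y) y) / 3); first by have := (cP y).1; lra.
  by exists n; lra.
(* Removing the closure of all earlier levels makes different levels disjoint. *)
pose C n := closure [set z | exists2 m, (m < n)%N & exists x, N m x z].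
pose U i := N i.1 i.2 `&` ~` C i.1.
have Uirr i j : U i `&` U j !=set0 -> ~ (i.1 < j.1)%N.
  move=> [z [[Nz _] [_ nC]]] ij; apply: nC; apply: subset_closure.
  by exists i.1 => //; exists i.2.
exists U; split.
- by move=> i; apply: openI => //; exact/closed_openC/closed_closure.
- move=> i j ij; have ji : U j `&` U i !=set0 by rewrite setIC.
  have e1 : i.1 = j.1.
    by case: (ltngtP i.1 j.1) => // h; [case: (Uirr i j ij h)|case: (Uirr j i ji h)].
  move: ij => [z [[Nz _] [Nz' _]]]; case: i j e1 Nz Nz' {ji} => [n x] [_ x'] /= <-.
  by move=> Nz Nz'; rewrite (NN n x x' z z Nz Nz') // dxx mesh_gt0.
- move=> y; have [m mP] := SN y.
  (* This ball lies in [N m (c y)], so it misses all levels beyond [m]. Its points are less than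
     [mesh m] apart, so it meets at most one member of each level up to [m]. *)
  exists [set z | d y z < mesh m / 2].
    by apply: nbhs_dist; have := mesh_gt0 m; lra.
  have /choice[g gP] : forall n, exists x, forall x', (n <= m)%N ->
      U (n, x') `&` [set z | d y z < mesh m / 2] !=set0 -> x' = x.
    move=> n; have [[x [z [[Nz _] /= yz]]]|nx] := pselect (exists x,
        U (n, x) `&` [set z | d y z < mesh m / 2] !=set0); last first.
      by exists y => x' _ ?; case: nx; exists x'.
    exists x => x' nm [z' [[Nz' _] /= yz']]; apply: NN Nz' Nz _.
    have := dT z' y z; rewrite (dC z' y); have := meshW nm; lra.
  apply: (@sub_finite_set _ _ ((fun n => (n, g n)) @` `I_m.+1)); last first.
    exact: finite_image (finite_II _).
  move=> [n x] Unx; have nm : (n <= m)%N.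
    rewrite leqNgt; apply/negP => mn; have [z [[_ nC] /= yz]] := Unx.
    apply: nC; apply: subset_closure; exists m => //; exists (c y), y => //.
    by have := mesh_gt0 m; lra.
  by exists n => //=; rewrite (gP n x nm Unx).
- move=> i x y [[x' [_ cx] xx] _] [[y' [_ cy] yy] _].
  have := mesh_gt0 i.1; have := dT x i.2 y.
  have := dT i.2 x' x; have := dT i.2 y' y; rewrite (dC x i.2); lra.
- move=> W oW [y Wy].
  (* Take the least level meeting [W]: as [W] is open and misses the earlier levels, it also misses
     their closure. *)
  have exn : exists n, `[< exists x, W `&` N n x !=set0 >].
    have [n nP] := SN y; exists n; apply/asboolP; exists (c y), y; split=> //.
    by exists y => //; rewrite dxx mesh_gt0.
  have [n /asboolP[x [z [Wz Nz]]] nmin] := ex_minnP exn.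
  exists (n, x), z; split=> //; split=> // Cz.
  have [t [[m mn [x' Nt]] Wt]] := Cz _ (open_nbhs_nbhs (conj oW Wz)).
  have : (n <= m)%N by apply: nmin; apply/asboolP; exists x', t.
  by rewrite leqNgt mn.
Qed.

End Distance.

(** * Cellularity *)

Lemma dependent_choice_fun (I : Type) (T : I -> Type) (P : forall i, T i -> Prop) :
  (forall i, exists x, P i x) -> exists f : forall i, T i, forall i, P i (f i).
Proof.
by move=> h; exists (fun i => projT1 (cid (h i))) => i; exact: projT2 (cid (h i)).
Qed.

Definition injects (I J : Type) := exists f : I -> J, injective f.

Lemma injects_trans I J L : injects I J -> injects J L -> injects I L.
Proof. by move=> [f fI] [g gI]; exists (g \o f); exact: inj_comp. Qed.

(** By Zorn's lemma there is a maximal graph of a partial injection; it is total on one side, since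
    otherwise a pair of unmatched elements could be added. *)
Lemma injects_total I J : injects I J \/ injects J I.
Proof.
pose P := [set A : set (I * J) | forall p q, A p -> A q -> p.1 = q.1 <-> p.2 = q.2].
have [F FP Ftot|A [AP Amax]] := @Zorn_bigcup _ P.
  move=> p q [B FB Bp] [C FC Cq].
  have [BC|CB] := Ftot B C FB FC; first exact: (FP C FC) (BC _ Bp) Cq.
  exact: (FP B FB) Bp (CB _ Cq).
have [AI|/existsNP[i0 ni0]] := pselect (forall i, exists j, A (i, j)).
  left; have /choice[f fA] := AI; exists f => i i' ff.
  exact: (AP _ _ (fA i) (fA i')).2.
have [AJ|/existsNP[j0 nj0]] := pselect (forall j, exists i, A (i, j)).
  right; have /choice[f fA] := AJ; exists f => j j' ff.
  exact: (AP _ _ (fA j) (fA j')).1.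
exfalso; apply: (Amax (A `|` [set (i0, j0)])).
  split; first by move=> p Ap; left.
  by move=> h; apply: ni0; exists j0; apply: h; right.
move=> [i j] [i' j'] /= [Aij|[-> ->]] [Aij'|[-> ->]] //=.
- exact: (AP _ _ Aij Aij').
- by split=> e; [case: ni0; exists j; rewrite -e|case: nj0; exists i; rewrite -e].
- by split=> e; [case: ni0; exists j'; rewrite e|case: nj0; exists i'; rewrite e].
Qed.

Lemma card_le_injects (T : Type) (A : set T) (L : Type) :
  A #<= [set: L] <-> exists f : A -> L, injective f.
Proof.
split=> [/card_leP[f]|[f fI]].
  exists (fun x => val (f x)) => x y /val_inj.
  by apply: (@inj _ _ _ f); rewrite inE.
apply/card_leP; have /injfunPex[] : exists2 g : A -> [set: L],
    set_fun [set: A] [set: [set: L]] g & set_inj [set: A] g; last by move=> g; squash g.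
exists (fun x => to_setT (f x)) => // x y _ _ /(congr1 val) /=.
exact: fI.
Qed.

Lemma injects_bij I J : injects I J -> injects J I ->
  exists (f : I -> J) (g : J -> I), cancel f g /\ cancel g f.
Proof.
have le A B : injects A B -> [set: A] #<= [set: B].
  move=> [f fI]; apply/card_le_injects; exists (f \o val).
  by apply: inj_comp => //; exact: val_inj.
move=> /le IJ /le JI; have /card_bijP[f [g fK gK]] := Cantor_Bernstein IJ JI.
exists (fun i => val (f (to_setT i))), (fun j => val (g (to_setT j))).
have inK (T : Type) (x : [set: T]) : to_setT (val x) = x by exact: val_inj.
by split=> x; rewrite inK ?fK ?gK.
Qed.

Section Cells.
Variable X : topologicalType.
Implicit Types (V W : set X).

Record cells W I (U : I -> set X) : Prop := Cells {
  cells_open : forall i, open (U i);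
  cells_nonempty : forall i, U i !=set0;
  cells_sub : forall i, U i `<=` W;
  cells_disjoint : forall i j, U i `&` U j !=set0 -> i = j }.

(** Uniform cellularity expressed by indexed families of open subsets of [X] instead of subspaces.
    [K] is only a least upper bound here; that it is attained is shown in [splits_uniform]. *)
Definition cellularity_within V (K : Type) :=
  (forall I (U : I -> set X), cells V U -> injects I K) /\
  (forall W, open W -> W !=set0 -> W `<=` V -> forall L : Type,
     (forall I (U : I -> set X), cells W U -> injects I L) -> injects K L).

Lemma uniform_cellularity_within V (K : Type) : open V ->
  uniform_cellularity V K -> cellularity_within V K.
Proof.
move=> oV [[VK _] Wmin]; split.
  move=> I U [oU nU UV dU].
  have [|f fI] := (card_le_injects _ _).1
    (VK [set B | exists i, B = set_val @^-1` U i] _).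
    split.
      move=> _ [i ->]; split; first by exists (U i).
      by have [x Ux] := nU i; exists (exist _ x (mem_set (UV i x Ux))).
    by move=> _ _ [i ->] [j ->] [x [Ux Ux']]; rewrite (dU i j) //; exists (val x).
  pose F := [set B : set V | exists i, B = set_val @^-1` U i].
  have bF i : set_val @^-1` U i \in F by rewrite inE; exists i.
  pose b i := exist (fun B => B \in F) _ (bF i).
  exists (fun i => f (b i)) => i j /fI /(congr1 val) /= e; apply: dU.
  have [x Ux] := nU i; exists x; split=> //.
  have := congr1 (fun B => B (exist _ x (mem_set (UV i x Ux)))) e.
  by rewrite /preimage /= => <-.
move=> W oW [x Wx] WV L WL.
pose W' : set V := set_val @^-1` W.
have oW' : open W' by exists W.
have nW' : W' !=set0 by exists (exist _ x (mem_set (WV x Wx))).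
have [_ Wle] := Wmin W' oW' nW'.
have [|f fI] := (card_le_injects _ _).1 (Wle L _).
  move=> F [oF dF]; apply/card_le_injects.
  pose U (G : F) : set X := [set val (val y) | y in val G].
  apply: (WL F U); split.
  - move=> G.
    have [[_ [B oB <-] BG] _] := oF _ (set_mem (valP G)).
    have -> : U G = B `&` W.
      rewrite /U -BG; apply/seteqP; split=> [_ [y By <-]|z [Bz Wz]].
        by split=> //; have := valP y; rewrite inE.
      pose zV : V := exist _ z (mem_set (WV z Wz)).
      have zW : zV \in W' by rewrite inE.
      by exists (exist _ zV zW).
    exact: openI.
  - move=> G; have [_ [y Gy]] := oF _ (set_mem (valP G)).
    by exists (val (val y)), y.
  - by move=> G _ [y _ <-]; have := valP y; rewrite inE.
  - move=> G H [z [[y Gy <-] [y' Hy' /val_inj/val_inj yy]]].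
    apply: val_inj; apply: dF; [exact: set_mem (valP G)|exact: set_mem (valP H)|].
    by exists y; split=> //; rewrite -yy.
exists (fun k => f (to_setT k)) => k k' /fI /(congr1 val).
by [].
Qed.

Definition fine_cells W I (U : I -> set X) := cells W U /\ locally_finite U.

Definition splits W I := exists U : I -> set X, fine_cells W U.

Lemma splits_injects W I J : injects J I -> splits W I -> splits W J.
Proof.
move=> [g gI] [U [[oU nU UW dU] lU]]; exists (U \o g); split.
  by split=> [i|i|i|i j /dU/gI //]; [exact: oU|exact: nU|exact: UW].
exact: locally_finite_reindex.
Qed.

(** Near a point only finitely many [U i] matter, so intersecting the neighborhoods obtained for
    their subfamilies keeps the refined family locally finite. *)
Lemma splits_sum W I (J : I -> Type) (U : I -> set X) : fine_cells W U ->
  (forall i, splits (U i) (J i)) -> splits W {i & J i}.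
Proof.
move=> [[oU nU UW dU] lU] US; have /dependent_choice_fun[T TP] := US.
exists (fun s => T (tag s) (tagged s)); split; first split.
- by move=> [i j]; have [[oT _ _ _] _] := TP i; exact: oT.
- by move=> [i j]; have [[_ nT _ _] _] := TP i; exact: nT.
- move=> [i j]; have [[_ _ TU _] _] := TP i; apply: subset_trans (UW i); exact: TU.
- move=> [i j] [i' j'] /= [x [Tx Tx']].
  have [[_ _ TU dT] _] := TP i; have [[_ _ TU' _] _] := TP i'.
  have ii : i = i'.
    by apply: dU; exists x; split; [exact: TU Tx|exact: TU' Tx'].
  by subst i'; congr existT; apply: dT; exists x.
- move=> x; have [N xN fN] := lU x.
  have /choice[M MP] : forall i, exists M, nbhs x M /\
      finite_set [set j | T i j `&` M !=set0].
    by move=> i; have [_ /(_ x)[M xM fM]] := TP i; exists M.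
  exists (N `&` \bigcap_(i in [set i | U i `&` N !=set0]) M i).
    by apply: filterI => //; apply: filter_bigcap_finite => // i _; case: (MP i).
  apply: (@sub_finite_set _ _ (\bigcup_(i in [set i | U i `&` N !=set0])
     (existT J i @` [set j | T i j `&` M i !=set0]))).
    move=> [i j] [y [/= Ty [Ny My]]].
    have [[_ _ TU _] _] := TP i.
    have Ui : U i `&` N !=set0 by exists y; split=> //; exact: TU Ty.
    by exists i => //; exists j => //; exists y; split=> //; exact: My.
  apply: bigcup_finite => // i _; apply: finite_image; by case: (MP i).
Qed.

End Cells.

(** * Splitting an open set into exactly [K] small cells *)

Section Splitting.
Variables (R : realType) (X : topologicalType) (d : X -> X -> R).
Hypothesis dP : complete_distance d.
Local Open Scope ring_scope.
Implicit Types (V W : set X).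

Let dxx := dist_xx dP.
Let dC := dist_sym dP.
Let dT := dist_triangle dP.

Definition dense_cells W I (U : I -> set X) :=
  forall O, open O -> O `&` W !=set0 -> exists i, O `&` U i !=set0.

Lemma dense_cells_closure W I (U : I -> set X) x : dense_cells W U ->
  locally_finite U -> closure W x -> exists i, closure (U i) x.
Proof.
move=> dU lU cWx; apply: locally_finite_closure => // B xB.
have [|i [y [By Uy]]] := dU B° (open_interior B).
  have [y [Wy By]] := cWx _ (nbhs_interior xB); by exists y.
by exists y; split; [exists i|exact: interior_subset].
Qed.

Definition small_cells (e : R) W I (U : I -> set X) :=
  [/\ fine_cells W U, forall i x y, U i x -> U i y -> d x y <= e &
      dense_cells W U].

Lemma small_cells_exist (e : R) W : 0 < e -> open W ->
  exists (S : set (nat * X)) (U : S -> set X), small_cells e W U.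
Proof.
move=> e0 oW; have [|U [oU dU lU sU nU]] := small_disjoint_family dP (e := e / 2).
  lra.
pose S := [set i | W `&` U i !=set0].
exists S, (fun i => W `&` U (val i)); split.
- split.
    split.
    + by move=> i; exact: openI.
    + by move=> i; have := set_mem (valP i).
    + by move=> i x [].
    + move=> i j [x [[_ Ui] [_ Uj]]]; apply: val_inj; apply: dU; by exists x.
  apply: (@locally_finite_sub _ _ (U \o val)).
    by move=> i x [_ Ux]; exact: subset_closure.
  apply: locally_finite_reindex lU; exact: val_inj.
- by move=> i x y [_ Ux] [_ Uy]; rewrite [leRHS](splitr e); exact: sU Ux Uy.
- move=> O oO OW; have [i [x [[Ox Wx] Ux]]] := nU _ (openI oO oW) OW.
  have Si : i \in S by rewrite inE; exists x.
  by exists (exist _ i Si), x.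
Qed.

Lemma dist_closure (e : R) (A : set X) : (forall x y, A x -> A y -> d x y <= e) ->
  forall x y, closure A x -> closure A y -> d x y <= e.
Proof.
move=> Ae x y cx cy; rewrite leNgt; apply/negP => exy.
have r0 : 0 < (d x y - e) / 2 by lra.
have [x' [Ax' /= xx]] := cx _ (nbhs_dist dP x r0).
have [y' [Ay' /= yy]] := cy _ (nbhs_dist dP y r0).
have := Ae _ _ Ax' Ay'; have := dT x x' y; have := dT x' y' y.
by rewrite (dC y' y); lra.
Qed.

(** Cantor's intersection theorem, with the finite intersection property in place of
    monotonicity. *)
Lemma complete_nested (E : nat -> set X) : (forall n, closed (E n)) ->
  (forall n x y, E n x -> E n y -> d x y <= mesh R n) ->
  (forall n, exists x, forall m, (m <= n)%N -> E m x) ->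
  exists l, forall n, E n l.
Proof.
move=> cE sE /choice[u uE]; have [|l lP] := dist_complete dP (u := u).
  move=> e e0; have [N Ne] := mesh_small e0; exists N => m n Nm Nn.
  by apply: le_lt_trans Ne; apply: sE; exact: uE.
exists l => n; have /closure_id -> := cE n => B /(dist_nbhs dP)[e e0 eB].
have [N NP] := lP e e0; exists (u (maxn n N)); split.
  by apply: uE; exact: leq_maxl.
by apply: eB; apply: NP; exact: leq_maxr.
Qed.

(** If all small cell families of [W] were finite, an ultrafilter on the closure of [W] would
    contain the closure of one cell of each size and converge to their common point. The closure of
    [W] would then be a compact neighborhood. *)
Lemma splits_nat W : nowhere_locally_compact X -> open W -> W !=set0 ->
  splits W nat.
Proof.
move=> lX oW [w Ww].
have /choice[S /dependent_choice_fun[U UP]] : forall n, exists S : set (nat * X),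
    exists U : S -> set X, small_cells (mesh R n) W U.
  by move=> n; apply: small_cells_exist => //; exact: mesh_gt0.
have [[n nS]|fS] := pselect (exists n, infinite_set [set: S n]).
  move/infiniteP/card_le_injects : nS => [f fI].
  apply: (@splits_injects _ _ (S n)); last by exists (U n); case: (UP n).
  by exists (f \o to_setT) => j k /fI /(congr1 val).
have {}fS n : finite_set [set: S n] by apply: contrapT => h; apply: fS; exists n.
exfalso; apply: (lX w (closure W)); last first.
  apply: (@filterS _ (nbhs w) _ W); first exact: subset_closure.
  exact: open_nbhs_nbhs.
rewrite compact_ultra => F UF FW.
have /dependent_choice_fun[i iF] : forall n, exists i, F (closure (U n i)).
  move=> n; apply: contrapT => h.
  have FC : F (\bigcap_(i in [set: S n]) ~` closure (U n i)).
    apply: filter_bigcap_finite => // i _.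
    have [Fi|//] := in_ultra_setVsetC (closure (U n i)) UF.
    by case: h; exists i.
  have [x [cWx nUx]] := filter_ex (filterI FW FC).
  have [[_ lU] _ dU] := UP n.
  by have [j cj] := dense_cells_closure dU lU cWx; apply: (nUx j).
have diamE n x y : closure (U n (i n)) x -> closure (U n (i n)) y ->
    d x y <= mesh R n.
  by apply: dist_closure; have [_ + _] := UP n; apply.
have [|//||l lE] := @complete_nested (fun n => closure (U n (i n))).
- by move=> n; exact: closed_closure.
- move=> n; have FC : F (\bigcap_(m in `I_n.+1) closure (U m (i m))).
    apply: filter_bigcap_finite => //; exact: finite_II.
  by have [x xE] := filter_ex FC; exists x => m mn; exact: xE.
exists l; split.
  have [[[_ _ UW _] _] _ _] := UP 0%N; move: (lE 0%N); apply: closureS; exact: UW.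
move=> B /(dist_nbhs dP)[e e0 eB]; have [n ne] := mesh_small e0.
apply: filterS (iF n) => y yE; apply: eB; apply: le_lt_trans ne.
exact: diamE.
Qed.

Variables (V : set X) (K : Type).
Hypotheses (lX : nowhere_locally_compact X) (VK : cellularity_within V K).

(** Every non-empty open subset of [W] contains a small cell of some scale, so each cell family of
    [W] injects into the set of all these small cells; [K] is the least such bound. *)
Lemma uniform_injects_small_cells W (S : nat -> Type) (U : forall n, S n -> set X) :
  open W -> W !=set0 -> W `<=` V ->
  (forall n, small_cells (mesh R n) W (@U n)) -> injects K {n & S n}.
Proof.
move=> oW W0 WV UP; apply: (VK.2 W oW W0 WV) => J T [oT nT TW dTT].
have /choice[h hT] : forall j, exists s : {n & S n}, U _ (tagged s) `<=` T j.
  move=> j; have [y Ty] := nT j.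
  have [e e0 eT] := (open_distP dP _).1 (oT j) y Ty.
  have [|n ne] := @mesh_small R (e / 2); first lra.
  have [_ sU dU] := UP n.
  have e20 : 0 < e / 2 by lra.
  have [||i [z [/interior_subset /= yz Uz]]] := dU [set z | d y z < e / 2]°.
  - exact: open_interior.
  - exists y; split; last exact: TW Ty.
    exact: nbhs_dist.
  exists (existT _ n i) => t Ut; apply: eT.
  by have := sU i z t Uz Ut; have := dT y z t; lra.
exists h => j j' jj; apply: dTT.
have [[[_ nU _ _] _] _ _] := UP (tag (h j)).
have [x Ux] := nU (tagged (h j)); exists x; split; first exact: hT Ux.
by apply: hT; rewrite -jj.
Qed.

(* Let [S j] index the cells of [W] of size [mesh j] and [T] be an infinite
   locally finite family in [W]. Either every [T j] contains a cell family indexed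
   by [S j], and [K] embeds in the disjoint union of the [S j]; or for some [j] all
   the small cell families of [T j] have at most [S j] members, and [K] embeds in
   [S j * nat]. *)
Lemma splits_uniform W : open W -> W !=set0 -> W `<=` V -> splits W K.
Proof.
move=> oW W0 WV; have [T fT] := splits_nat lX oW W0.
have [[oT nT TW _] _] := fT.
have /choice[S /dependent_choice_fun[U UP]] : forall n,
    exists (S : set (nat * X)) (U : S -> set X), small_cells (mesh R n) W U.
  by move=> n; apply: small_cells_exist => //; exact: mesh_gt0.
have [A AP] : exists A : nat -> nat -> set (nat * X), forall j n,
    exists U : A j n -> set X, small_cells (mesh R n) (T j) U.
  have /choice[A AP] : forall p : nat * nat, exists A : set (nat * X),
    exists U : A -> set X, small_cells (mesh R p.2) (T p.1) U.
    move=> p; apply: small_cells_exist; [exact: mesh_gt0|exact: oT].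
  by exists (fun j n => A (j, n)) => j n; exact: AP (j, n).
have [h|/existsNP[j nj]] := pselect (forall j, exists n, injects (S j) (A j n)).
  apply: (@splits_injects _ _ {j & S j}).
    by apply: (uniform_injects_small_cells (W := W) (U := U)).
  apply: (splits_sum fT) => j; have [n jn] := h j.
  by apply: splits_injects jn _; have [B [fB _ _]] := AP j n; exists B.
have Aj n : injects (A j n) (S j).
  by have [//|h] := injects_total (A j n) (S j); case: nj; exists n.
have [B BP] : exists B : forall n, A j n -> set X, forall n,
    small_cells (mesh R n) (T j) (B n).
  by have /dependent_choice_fun[B BP] := AP j; exists B.
have [fU _ _] := UP j.
apply: (@splits_injects _ _ {i : S j & nat}); last first.
  apply: (splits_sum fU) => i; apply: splits_nat => //; last first.
    by have [[_ nU _ _] _] := fU; exact: nU.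
  by have [[oU _ _ _] _] := fU; exact: oU.
apply: (@injects_trans _ {n & A j n}).
  apply: (uniform_injects_small_cells (W := T j) (U := B)) => //.
  by apply: subset_trans WV; exact: TW.
have /dependent_choice_fun[g gI] := Aj.
exists (fun s => existT (fun=> nat) (g _ (tagged s)) (tag s)).
move=> [n a] [n' a'] /= e; have en : n = n' :=
  congr1 (fun s : {_ : S j & nat} => tagged s : nat) e.
subst n'; congr existT; apply: (gI n); exact: (congr1 tag e).
Qed.

(** Intersect a small dense family [T] with [K] locally finite cells [G k] and, as [None], with what
    remains outside their closure. Each [G k] meets some member of [T], so at least [K] cells arise;
    cellularity allows no more. *)
Lemma split_uniform (e : R) W : 0 < e -> open W -> W !=set0 -> W `<=` V ->
  exists U : K -> set X, small_cells e W U.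
Proof.
move=> e0 oW W0 WV; have [G [[oG nG GW dG] lG]] := splits_uniform oW W0 WV.
have [S [T [[[oT nT TW dTT] lT] sT deT]]] := small_cells_exist e0 oW.
pose H (o : option K) := if o is Some k then G k else W `\` closure (\bigcup_k G k).
have oH o : open (H o).
  case: o => [k|]; first exact: oG.
  by apply: openI => //; exact/closed_openC/closed_closure.
have dH o o' : H o `&` H o' !=set0 -> o = o'.
  move=> [x]; case: o => [k|]; case: o' => [k'|] //= -[].
  - by move=> Gx Gx'; rewrite (dG k k') //; exists x.
  - by move=> Gx [_ []]; apply: subset_closure; exists k.
  - by move=> [_ nGx] Gx; case: nGx; apply: subset_closure; exists k'.
pose J := [set s : option K * S | H s.1 `&` T s.2 !=set0].
pose Q (s : J) := H (val s).1 `&` T (val s).2.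
have cQ : cells W Q.
  split.
  - by move=> s; exact: openI.
  - by move=> s; have := set_mem (valP s).
  - by move=> s x [_ /TW].
  - move=> s s' [x [[Hx Tx] [Hx' Tx']]]; apply: val_inj.
    rewrite [LHS]surjective_pairing [RHS]surjective_pairing; congr pair.
      by apply: dH; exists x.
    by apply: dTT; exists x.
have dQ : dense_cells W Q.
  move=> O oO OW.
  have [c [x [Ox Hx]]] : exists c, O `&` H c !=set0.
    have [[k [x [Ox Gx]]]|nG'] := pselect (exists k, O `&` G k !=set0).
      by exists (Some k), x.
    have [x [Ox Wx]] := OW; exists None, x; split=> //; split=> // cx.
    have [y [[k _ Gy] Oy]] := cx _ (open_nbhs_nbhs (conj oO Ox)).
    by apply: nG'; exists k, y.
  have HW : H c `<=` W by case: (c) => [k|] y; [exact: GW|case].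
  have [|i [y [[Oy Hy] Ty]]] := deT (O `&` H c) (openI oO (oH c)).
    by exists x; split=> //; exact: HW.
  have Js : (c, i) \in J by rewrite inE; exists y.
  by exists (exist _ (c, i) Js), y.
have lQ : locally_finite Q.
  move=> x; have [N xN fN] := lG x; have [M xM fM] := lT x.
  exists (N `&` M); first exact: filterI.
  have fB : finite_set ((None |` (Some @` [set k | G k `&` N !=set0])) `*`
      [set i | T i `&` M !=set0]).
    apply: finite_setX => //; rewrite finite_setU; split; first exact: finite_set1.
    exact: finite_image.
  have := finite_preimage (f := fun s : J => val s) _ fB.
  move=> /(_ (fun s s' _ _ => @val_inj _ _ _ s s')).
  apply: sub_finite_set => -[[c i] Js] [y [[/= Hy Ty] [Ny My]]]; split=> /=; last first.
    by exists y.
  case: c Js Hy => [k|] Js Hy; last by left.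
  by right; exists k => //; exists y.
have [||f [g [fK gK]]] := @injects_bij K J.
- have /choice[s sP] : forall k, exists s : J, (val s).1 = Some k.
    move=> k; have [x Gx] := nG k.
    have [|i [y [Gy Ty]]] := deT (G k) (oG k).
      by exists x; split=> //; exact: GW Gx.
    have Js : (Some k, i) \in J by rewrite inE; exists y.
    by exists (exist _ (Some k, i) Js).
  exists s => k k' ss; have := sP k; rewrite ss sP.
  by case.
- apply: (VK.1 J Q); case: cQ => ? ? QW ?; split=> // i; exact: subset_trans WV.
exists (Q \o f); split.
- split; last by apply: locally_finite_reindex lQ; exact: can_inj fK.
  have [oQ nQ QW dQQ] := cQ.
  split=> [i|i|i|i j /dQQ /(can_inj fK) //]; [exact: oQ|exact: nQ|exact: QW].
- by move=> k x y [_ Tx] [_ Ty]; exact: sT Tx Ty.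
- move=> O oO OW; have [s Os] := dQ O oO OW.
  by exists (g s); rewrite /= gK.
Qed.

End Splitting.

(** * The tree of cells *)

(** Dependent choice along a tree: [w n] agrees with all later approximations on the first [n]
    coordinates. *)
Lemma baire_branch (K : Type) (P : nat -> baire_space K -> Prop) :
  (forall n z z', agree n z z' -> P n z -> P n z') -> (exists z, P 0%N z) ->
  (forall n z, P n z -> exists2 z', agree n z z' & P n.+1 z') ->
  exists z, forall n, P n z.
Proof.
move=> Pagree [z0 Pz0] Pstep.
have /choice[g gP] : forall p : nat * baire_space K, exists z',
    P p.1 p.2 -> agree p.1 p.2 z' /\ P p.1.+1 z'.
  move=> [n z] /=; have [/Pstep[z' zz' Pz']|nP] := pselect (P n z).
    by exists z'.
  by exists z.
pose w := fix w n := if n is m.+1 then g (m, w m) else z0.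
have Pw n : P n (w n).
  by elim: n => [//|n IH]; exact: (gP (n, w n) IH).2.
have ww m n : agree n (w n) (w (m + n)%N).
  elim: m => [//|m IH] i il; rewrite (IH i il).
  apply: (gP (_, w (m + n)%N) (Pw _)).1; exact: leq_trans il (leq_addl _ _).
(* Coordinate [i] is settled from stage [i.+1] on. *)
exists (fun i => w i.+1 i) => n; apply: Pagree (Pw n) => i il.
by rewrite -(subnK il) -(ww (n - i.+1)%N i.+1 i).
Qed.

Section Tree.
Variables (R : realType) (X : topologicalType) (d : X -> X -> R).
Hypothesis dP : complete_distance d.
Hypothesis lX : nowhere_locally_compact X.
Variables (V : set X) (K : Type).
Hypotheses (oV : open V) (V0 : V !=set0) (VK : cellularity_within V K).
Implicit Types (z : baire_space K).

Lemma uniform_resolution : exists f : baire_space K -> X, resolution V f.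
Proof.
(* The children of a set at a given level; the family is arbitrary for sets that cannot be cells. *)
have /choice[T TP] : forall p : nat * set X, exists U : K -> set X,
    open p.2 -> p.2 !=set0 -> p.2 `<=` V -> small_cells d (mesh R p.1) p.2 U.
  move=> [n W]; have [[oW W0 WV]|h] := pselect [/\ open W, W !=set0 & W `<=` V].
    have [U UP] := split_uniform dP lX VK (mesh_gt0 R n) oW W0 WV.
    by exists U.
  by exists (fun=> V) => oW W0 WV; case: h.
pose cell z := fix cell n := if n is m.+1 then T (m, cell m) (z m) else V.
have cellP z n : [/\ open (cell z n), cell z n !=set0 & cell z n `<=` V].
  elim: n => [|n [oc c0 cV]] /=; first by split.
 
  have [[[oU nU UW _] _] _ _] := TP (n, cell z n) oc c0 cV.
  by split; [exact: oU|exact: nU|exact: subset_trans (UW _) cV].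
have smallT z n : small_cells d (mesh R n) (cell z n) (T (n, cell z n)).
  by have [oc c0 cV] := cellP z n; exact: (TP (n, cell z n)).
have cell_agree n z z' : agree n z z' -> cell z n = cell z' n.
  elim: n => [//|n IH] zz /=; rewrite (IH (agreeW (leqnSn n) zz)).
  by rewrite (zz n).
have cellW z m n : (m <= n)%N -> cell z n `<=` cell z m.
  elim: n => [|n IH]; first by rewrite leqn0 => /eqP ->.
  rewrite leq_eqVlt => /orP[/eqP -> //|/IH nm]; apply: subset_trans nm => /=.
  by have [[[_ _ UW _] _] _ _] := smallT z n; exact: UW.
have cell_meet n z z' : cell z n `&` cell z' n !=set0 -> agree n z z'.
  elim: n => [//|n IH] [x [cx cx']].
  have zz : agree n z z'.
    by apply: IH; exists x; split; [apply: cellW cx|apply: cellW cx'].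
  move=> i; rewrite ltnS leq_eqVlt => /orP[/eqP ->|/zz //].
  have [[[_ _ _ dU] _] _ _] := smallT z n.
  by apply: dU; exists x; split=> //; move: cx' => /=; rewrite (cell_agree _ _ _ zz).
have cell_small z n x y : closure (cell z n.+1) x -> closure (cell z n.+1) y ->
    (d x y <= mesh R n)%R.
  by apply: (dist_closure dP); have [_ + _] := smallT z n; apply.
have /choice[f fP] : forall z, exists x, forall n, closure (cell z n) x.
  move=> z; have [|||x xP] :=
    @complete_nested R X d dP (fun n => closure (cell z n.+1)).
  - by move=> n; exact: closed_closure.
  - by move=> n x y; exact: cell_small.
  - move=> n; have [_ [x cx] _] := cellP z n.+1; exists x => m mn.
    by apply: subset_closure; apply: cellW cx.
  by exists x => n; move: (xP n); apply: closureS; exact: cellW.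
have f_unique z x : (forall n, closure (cell z n) x) -> f z = x.
  move=> xP; apply: (dist_eq0 dP); apply/eqP; rewrite eq_le (dist_ge0 dP) andbT.
  rewrite leNgt; apply/negP => /mesh_small[n]; rewrite ltNge => /negP; apply.
  exact: cell_small (fP z n.+1) (xP n.+1).
(* The children are locally finite and dense, so their closures cover the closure of the parent and
   a branch can be followed towards [x]. *)
have VonC x : closure V x -> exists z, f z = x.
  move=> Vx; have [|||z zP] := @baire_branch K (fun n z => closure (cell z n) x).
  - by move=> n z z' /cell_agree ->.
  - have [k _] : exists k, closure (T (0%N, V) k) x.
      have [[_ lU] _ dU] : small_cells d (mesh R 0) V (T (0%N, V)).
        exact: (TP (0%N, V)).
      exact: dense_cells_closure dU lU Vx.
    by exists (fun=> k).
  - move=> n z zx; have [[_ lU] _ dU] := smallT z n.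
    have [k kx] := dense_cells_closure dU lU zx.
    pose z' : baire_space K := fun i => if i == n then k else z i.
    have zz : agree n z z' by move=> i il; rewrite /z' ltn_eqF.
    by exists z' => //=; rewrite -(cell_agree _ _ _ zz) /z' eqxx.
  by exists z; exact: f_unique.
exists f; split.
- move=> z A /(dist_nbhs dP)[e e0 eA]; have [n ne] := mesh_small e0.
  apply: (@filterS _ (nbhs z) _ (agree n.+1 z)); last exact: nbhs_agree.
  move=> z' zz; apply: eA; apply: le_lt_trans ne.
  by apply: (cell_small z); [|rewrite (cell_agree _ _ _ zz)]; exact: fP.
(* Given [x] in the closure of the image, local finiteness of the children allows choosing a branch
   [z] such that [x] stays in the closure of the image of every neighborhood of [z] in [A]. Then [z]
   is in [A], which is closed, and [f z = x]. *)
- move=> A cA; rewrite closedE => x /= xA.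
  have {}xA : closure (f @` A) x.
    by move=> B xB; apply: contrapT => nB; apply: xA; apply: filterS xB => y By fy;
      apply: nB; exists y.
  have [|||z zP] := @baire_branch K (fun n z => closure (f @` (A `&` agree n z)) x).
  - move=> n z z' zz; apply: closureS; apply: image_subset => y [Ay yz]; split=> //.
    by move=> i il; rewrite -zz // yz.
  - have [_ [[z _ _] _]] := xA setT filterT; exists z.
    by move: xA; apply: closureS; apply: image_subset.
  - move=> n z zx; have [[_ lU] _ _] := smallT z n.
    pose z' k : baire_space K := fun i => if i == n then k else z i.
    have zz k : agree n z (z' k) by move=> i il; rewrite /z' ltn_eqF.
    have lA : locally_finite (fun k => f @` (A `&` agree n.+1 (z' k))).
      apply: locally_finite_sub lU => k _ [y [_ yz] <-].
      have := fP y n.+1; rewrite -(cell_agree _ _ _ yz) /= /z' eqxx.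
      by rewrite -(cell_agree _ _ _ (zz k)).
    have [|k kx] := locally_finite_closure lA (x := x).
      move: zx; apply: closureS => _ [y [Ay yz] <-]; exists (y n) => //.
      exists y => //.
      split=> // i; rewrite ltnS leq_eqVlt /z' => /orP[/eqP ->|il].
        by rewrite eqxx.
      by rewrite ltn_eqF // yz.
    by exists (z' k).
  exists z.
    have /closure_id -> := cA; move=> B; rewrite nbhsE => -[D [oD Dz] DB].
    have [n nD] := oD z Dz; have [_ [[y [Ay yz] _] _]] := zP n setT filterT.
    by exists y; split=> //; apply: DB; exact: nD.
  apply: f_unique => n; move: (zP n).
  rewrite [closure (cell z n)](closure_id _).1; last exact: closed_closure.
  apply: closureS => _ [y [_ yz] <-]; rewrite (cell_agree _ _ _ yz); exact: fP.
- by move=> _ [z _ <-]; exact: fP z 0%N.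
- by move=> x /subset_closure/VonC[z fz]; exists z.
(* If [f z'] lies in the open cell of [z] at level [n], this cell meets that of [z'], since [f z']
   is in the closure of the latter; so [z] and [z'] agree up to [n]. *)
- move=> O oO [z Oz]; have [n nO] := oO z Oz.
  have [oc c0 cV] := cellP z n; exists (cell z n); split=> // z' cz'.
  apply: nO; apply: cell_meet.
  have [y [cy cy']] := fP z' n _ (open_nbhs_nbhs (conj oc cz')).
  by exists y.
Qed.

End Tree.

(** * Resolutions by Baire spaces and the homeomorphism of remote points *)

Lemma uniform_cellularity_nonempty (X : topologicalType) (V : set X) (K : Type) :
  uniform_cellularity V K -> infinite_set [set: K] -> V !=set0.
Proof.
move=> [[_ Vmin] _] infK; apply: contrapT => V0.
(* In an empty [V] all cellular families are empty, so the empty type bounds them. *)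
have /card_le_injects[f _] : [set: K] #<= [set: False].
  apply: Vmin => F [oF _]; apply/card_le_injects; suff F0 : forall G, ~ F G.
    exists (fun G : F => F0 _ (set_mem (valP G))) => G.
    by case: (F0 _ (set_mem (valP G))).
  by move=> G /oF[_ [x _]]; apply: V0; exists (val x); exact: set_mem (valP x).
have [k _] := infinite_setN0 infK; exact: f (to_setT k).
Qed.

Lemma uniform_cellularity_resolution (R : realType) (X : topologicalType)
    (V : set X) (K : Type) :
  nowhere_locally_compact X -> completely_metrizable R X -> open V ->
  uniform_cellularity V K -> infinite_set [set: K] ->
  exists f : baire_space K -> X, resolution V f.
Proof.
move=> lX /completely_metrizable_distance[d dP] oV uV infK.
apply: (uniform_resolution dP lX oV) (uniform_cellularity_within oV uV).
exact: uniform_cellularity_nonempty uV infK.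
Qed.

Lemma avoiding_open_set (R : realType) (K : Type) (O : set (baire_space K)) :
  infinite_set [set: K] -> open O -> O !=set0 ->
  exists p : stone_cech R (baire_space K),
    avoiding p /\ closure (to_stone_cech R @` O) p.
Proof.
move=> /infiniteP/card_le_injects[iota iotaI] oO [z Oz].
have [n nO] := cylinder_base oO Oz.
have [|p [ap pz]] := @avoiding_cylinder R K (iota \o to_setT) _ (mkseq z n).
  by move=> i j /iotaI /(congr1 val).
by exists p; split=> //; move: pz; apply: closureS; apply: image_subset.
Qed.

Theorem corollary5p13 (R : realType) (X Y : topologicalType) :
  nowhere_locally_compact X -> completely_metrizable R X ->
  nowhere_locally_compact Y -> completely_metrizable R Y ->
  same_cellular_type X Y ->
  exists (U : set (remote_points R X)) (V : set (remote_points R Y)),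
    [/\ open U, dense U, open V, dense V & homeomorphic U V].
Proof.
move=> lX mX lY mY [S [[V [oV tV dV uV]] [W [oW tW dW uW]]]].
have infS (s : {i : cd_index S & cd_phi i}) := @cd_card_infinite S (tag s).
have [dX dXP] := completely_metrizable_distance mX.
have [dY dYP] := completely_metrizable_distance mY.
have nX := dist_normal dXP; have hX := dist_hausdorff dXP.
have nY := dist_normal dYP; have hY := dist_hausdorff dYP.
(* The resolutions of [V s] and [W s] have the same domain, the Baire space over [cd_card (tag s)],
   because the cellular data are shared. *)
have /dependent_choice_fun[f rf] s :=
  uniform_cellularity_resolution lX mX (oV s) (uV s) (infS s).
have /dependent_choice_fun[g rg] s :=
  uniform_cellularity_resolution lY mY (oW s) (uW s) (infS s).
have aZ (s : {i : cd_index S & cd_phi i})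
    (O : set (baire_space (cd_card (tag s)))) : open O -> O !=set0 ->
    exists p : stone_cech R (baire_space (cd_card (tag s))),
      avoiding p /\ closure (to_stone_cech R @` O) p.
  exact: avoiding_open_set.
exists (@remote_pieces R X _ V), (@remote_pieces R Y _ W); split.
- exact: remote_pieces_open.
- exact: (remote_pieces_dense nX hX lX oV rf).
- exact: remote_pieces_open.
- exact: (remote_pieces_dense nY hY lY oW rg).
- exact: (remote_pieces_homeomorphic R rf rg).
Qed.
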